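(* Let $\mathcal{H}=\mathcal{V}\oplus\mathcal{W}^{\perp}$. Let $(\mathbf{W},\mathbf{w})$ be a fusion frame for $\mathcal{W}$ and $(\mathbf{V},\mathbf{v})$ a fusion frame for $\mathcal{V}$. Let $Q\in B(\mathcal{K}_{\mathbf{W}},\mathcal{K}_{\mathbf{V}})$ and assume that $(\mathbf{V},\mathbf{v})$ is an $\epsilon$-approximate oblique $Q$-dual fusion frame of $(\mathbf{W},\mathbf{w})$ on $\mathcal{V}$ with $0\le\epsilon<1$. Put $A=\sum_{n=0}^{\infty}\left(\pi_{\mathcal{V},\mathcal{W}^{\perp}}-T_{\mathbf{V},\mathbf{v}}QT_{\mathbf{W},\mathbf{w}}^{*}\right)^{n}=\left(I-(\pi_{\mathcal{V},\mathcal{W}^{\perp}}-T_{\mathbf{V},\mathbf{v}}QT_{\mathbf{W},\mathbf{w}}^{*})\right)^{-1}\in B(\mathcal{H})$. Let $\widetilde{\mathbf{v}}=\{\widetilde v_k\}_{k\in I}$ and $\widetilde{\mathbf{w}}=\{\widetilde w_k\}_{k\in I}$ be two families of weights. Assume that $(A\mathbf{V},\widetilde{\mathbf{v}})$ and $(A^{*}\mathbf{W},\widetilde{\mathbf{w}})$ are fusion Bessel sequences for $\mathcal{V}$ and $\mathcal{W}$, respectively, and that $Q_{AT_{\mathbf{V},\mathbf{v}},\widetilde{\mathbf{v}}}$ and $Q_{A^{*}T_{\mathbf{W},\mathbf{w}},\widetilde{\mathbf{w}}}$ are well defined bounded operators. Then: (i) $(A\mathbf{V},\widetilde{\mathbf{v}})$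 is an oblique $Q_{AT_{\mathbf{V},\mathbf{v}},\widetilde{\mathbf{v}}}Q$-dual fusion frame of $(\mathbf{W},\mathbf{w})$ on $\mathcal{V}$. (ii) $(A^{*}\mathbf{W},\widetilde{\mathbf{w}})$ is an oblique $Q_{A^{*}T_{\mathbf{W},\mathbf{w}},\widetilde{\mathbf{w}}}Q^{*}$-dual fusion frame of $(\mathbf{V},\mathbf{v})$ on $\mathcal{W}$. (iii) If $Q$ is surjective (respectively injective) and $\widetilde Q:\mathcal{K}_{\mathbf{V}}\to\mathcal{K}_{\mathbf{W}}$ is a bounded right (respectively left) inverse of $Q$, then $(A\mathbf{V},\widetilde{\mathbf{v}})$ is an $\frac{\epsilon}{1-\epsilon}$-approximate oblique $Q_{AT_{\mathbf{V},\mathbf{v}},\widetilde{\mathbf{v}}}\,Q\,Q_{A^{*}T_{\mathbf{W},\mathbf{w}},\widetilde{\mathbf{w}}}^{*}$-dual fusion frame of $(A^{*}\mathbf{W},\widetilde{\mathbf{w}})$ on $\mathcal{V}$.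
   Context: $\mathcal{H}$ is a separable Hilbert space over $\mathbb{R}$ or $\mathbb{C}$, $\mathcal{V},\mathcal{W}$ are closed subspaces of $\mathcal{H}$, $I$ is a countable index set (the symbol $I$ also denotes the identity operator of $\mathcal{H}$), and $B(\cdot,\cdot)$ denotes bounded linear operators. $\mathcal{H}=\mathcal{V}\oplus\mathcal{W}^{\perp}$ means a direct (not necessarily orthogonal) sum; it is equivalent to $\mathcal{H}=\mathcal{W}\oplus\mathcal{V}^{\perp}$. $\pi_{\mathcal{V},\mathcal{W}^{\perp}}$ is the oblique projection with image $\mathcal{V}$ and kernel $\mathcal{W}^{\perp}$, and $\pi_{\mathcal{W},\mathcal{V}^{\perp}}$ the one with image $\mathcal{W}$ and kernel $\mathcal{V}^{\perp}$. Families of subspaces: $\mathbf{W}=\{W_i\}_{i\in I}$ is a family of closed subspaces of $\mathcal{W}$ and $\mathbf{w}=\{w_i\}_{i\in I}$ a family of weights, i.e. $w_i>0$ for all $i$ (all families of weights are assumed to be in $\ell^\infty(I)$); $(\mathbf{W},\mathbf{w})$ stands for $\{(W_i,w_i)\}_{i\in I}$. $\mathcal{K}_{\mathbf{W}}=\oplus_{i\in I}W_i$ is the Hilbert ($\ell^2$) direct sum. $(\mathbf{W},\mathbf{w})$ is a fusion frame for $\mathcal{W}$ if there are $0<\alpha\le\beta<\infty$ with $\alpha\|f\|^2\le\sum_{i\in I}w_i^2\|\pi_{W_i}f\|^2\le\beta\|f\|^2$ for all $f\in\mathcal{W}$ ($\pi_{W_i}$ the orthogonal projection onto $W_i$); it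 is a fusion Bessel sequence for $\mathcal{W}$ if only the upper inequality is required. In that case the synthesis operator $T_{\mathbf{W},\mathbf{w}}:\mathcal{K}_{\mathbf{W}}\to\mathcal{H}$, $(f_i)_{i}\mapsto\sum_i w_if_i$, is bounded, with adjoint $T_{\mathbf{W},\mathbf{w}}^{*}f=(w_i\pi_{W_i}f)_{i}$. The same notation is used for $(\mathbf{V},\mathbf{v})$ with closed subspaces $V_i$ of $\mathcal{V}$. For an operator $A$, $A\mathbf{V}=\{AV_i\}_{i\in I}$. For $\epsilon\ge0$ and $Q\in B(\mathcal{K}_{\mathbf{W}},\mathcal{K}_{\mathbf{V}})$, a fusion frame $(\mathbf{V},\mathbf{v})$ for $\mathcal{V}$ is an $\epsilon$-approximate oblique $Q$-dual fusion frame of the fusion frame $(\mathbf{W},\mathbf{w})$ for $\mathcal{W}$ on $\mathcal{V}$ if $\|T_{\mathbf{V},\mathbf{v}}QT_{\mathbf{W},\mathbf{w}}^{*}-\pi_{\mathcal{V},\mathcal{W}^{\perp}}\|\le\epsilon$; for $\epsilon=0$ it is called an oblique $Q$-dual fusion frame. The same definition with the roles of $\mathcal{V}$ and $\mathcal{W}$ exchanged (using $\pi_{\mathcal{W},\mathcal{V}^{\perp}}$) gives duals on $\mathcal{W}$. For $j\in I$, $M_j$ denotes the operator on a space $\mathcal{K}_{\mathbf{U}}$ which keeps the $j$-th component and replaces all the others by $0$. For a bounded operator $L$ on $\mathcal{K}_{\mathbf{U}}$ with values in $\mathcal{V}$ or $\mathcal{W}$ and weights $\mathbf{u}=\{u_i\}$,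 $Q_{L,\mathbf{u}}$ is the map on $\mathcal{K}_{\mathbf{U}}$ given by $Q_{L,\mathbf{u}}(f_j)_{j\in I}=\left(\frac{1}{u_i}LM_i(f_j)_{j\in I}\right)_{i\in I}$, with values in $\oplus_{i\in I}LM_i\mathcal{K}_{\mathbf{U}}$. Thus $Q_{AT_{\mathbf{V},\mathbf{v}},\widetilde{\mathbf{v}}}:\mathcal{K}_{\mathbf{V}}\to\mathcal{K}_{A\mathbf{V}}$, $(f_i)_i\mapsto\left(\frac{v_i}{\widetilde v_i}Af_i\right)_i$, and $Q_{A^{*}T_{\mathbf{W},\mathbf{w}},\widetilde{\mathbf{w}}}:\mathcal{K}_{\mathbf{W}}\to\mathcal{K}_{A^{*}\mathbf{W}}$, $(f_i)_i\mapsto\left(\frac{w_i}{\widetilde w_i}A^{*}f_i\right)_i$. *)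

(* Defs.v *)
From mathcomp Require Import all_boot all_order all_algebra finmap.
From mathcomp Require Import complex.
From mathcomp Require Import all_classical all_reals all_analysis.
From mathcomp Require summability.

Set Implicit Arguments.
Unset Strict Implicit.
Unset Printing Implicit Defensive.

Import Order.TTheory GRing.Theory Num.Theory.
Import numFieldNormedType.Exports.

Local Open Scope classical_set_scope.
Local Open Scope ring_scope.

(* A library norm on H is valued in the scalar field; weights, frame bounds and
   the norms below are valued in R. *)
Variant scalar_kind := RealScalars | ComplexScalars.

Section scalars.
Variable R : realType.

Definition RorC (k : scalar_kind) : numFieldType :=
  match k with RealScalars => R | ComplexScalars => R[i] end.

Definition of_real {k : scalar_kind} : R -> RorC k :=
  match k with
  | RealScalars => fun r => r
  | ComplexScalars => fun r => Complex r 0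
  end.

Definition re {k : scalar_kind} : RorC k -> R :=
  match k with
  | RealScalars => fun z => z
  | ComplexScalars => fun z => complex.Re z
  end.

Definition conj_scalar {k : scalar_kind} : RorC k -> RorC k :=
  match k with
  | RealScalars => fun z => z
  | ComplexScalars => fun z => conjc z
  end.

End scalars.

Arguments conj_scalar R k z : clear implicits.

(* An inner product space carved out of a module. Operators between such spaces
   are total functions of which only the values on the domain matter. *)
Section operators.
Variables (R : realType) (k : scalar_kind).
Local Notation K := (RorC R k).

Record ip_space := IpSpace {
  car : lmodType K;
  dom : set car;
  ip : car -> car -> K }.

Definition norm (X : ip_space) (x : car X) : R := Num.sqrt (re (ip x x)).

Definition bounded_operator (X Y : ip_space) (L : car X -> car Y) : Prop :=
  [/\ forall x, dom x -> dom (L x),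
      forall (a : K) x y, dom x -> dom y -> L (a *: x + y) = a *: L x + L y
    & exists C : R, forall x, dom x -> norm (L x) <= C * norm x].

Definition opnorm (X Y : ip_space) (L : car X -> car Y) : \bar R :=
  ereal_sup [set (norm (L x))%:E | x in [set x | dom x /\ norm x <= 1]].

Definition is_adjoint (X Y : ip_space)
    (L : car X -> car Y) (M : car Y -> car X) : Prop :=
  bounded_operator M /\
  forall x y, dom x -> dom y -> ip (L x) y = ip x (M y).

(* Unique on dom Y; unspecified outside it. *)
Definition adjoint (X Y : ip_space) (L : car X -> car Y) : car Y -> car X :=
  xget (fun=> 0) [set M | is_adjoint L M].

(* Convergence of the series of operators F n to A in operator norm. *)
Definition opseries_cvg (X : ip_space) (F : nat -> car X -> car X)
    (A : car X -> car X) : Prop :=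
  bounded_operator A /\
  (fun N => opnorm (fun x => \sum_(n < N) F n x - A x)) @ \oo --> 0%E.

Definition opseries (X : ip_space) (F : nat -> car X -> car X) :
    car X -> car X :=
  xget (fun=> 0) [set A | opseries_cvg F A].

End operators.

Arguments dom {R k} i _.
Arguments norm {R k} X x.
Arguments bounded_operator {R k} X Y L.
Arguments opnorm {R k} X Y L.
Arguments is_adjoint {R k} X Y L M.
Arguments adjoint {R k} X Y L.
Arguments opseries_cvg {R k} X F A.
Arguments opseries {R k} X F.

Section fusion.
Variables (R : realType) (k : scalar_kind).
Local Notation K := (RorC R k).
Variables (H : completeNormedModType K) (dot : {dot H for @conj_scalar R k}).
Variable I : countType.

Definition separable : Prop := exists2 S : set H, countable S & dense S.

Definition closed_subspace (U : set H) : Prop :=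
  [/\ U 0, forall (a : K) x y, U x -> U y -> U (a *: x + y) & closed U].

Definition orth (U : set H) : set H := [set x | forall y, U y -> dot x y = 0].

Definition direct_sum (U V : set H) : Prop :=
  (forall f, exists2 u, U u & V (f - u)) /\ U `&` V = [set 0].

(* The projection with image U and kernel V when H is the direct sum of both. *)
Definition oblique_proj (U V : set H) (f : H) : H :=
  xget 0 [set u | U u /\ V (f - u)].

Definition orth_proj (U : set H) : H -> H := oblique_proj U (orth U).

Definition Hspace : ip_space R k := IpSpace [set: H] dot.

Definition hnorm (f : H) : R := norm Hspace f.

(* The Hilbert direct sum of the U i. Vector sums over I are unconditional: limits
   over the directed set of finite subsets of I. *)
Definition Kspace (U : I -> set H) : ip_space R k :=
  IpSpace (car := (I -> H : lmodType K))
    [set x | (forall i, U i (x i)) /\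
             (\esum_(i in [set: I]) (hnorm (x i) ^+ 2)%:E < +oo)%E]
    (fun x y => summability.sum (fun i => dot (x i) (y i) : K^o)).

Definition weights (u : I -> R) : Prop :=
  (forall i, 0 < u i) /\ exists C, forall i, u i <= C.

Definition weighted_family (S : set H) (U : I -> set H) (u : I -> R) : Prop :=
  (forall i, closed_subspace (U i) /\ U i `<=` S) /\ weights u.

Definition frame_sum (U : I -> set H) (u : I -> R) (f : H) : \bar R :=
  (\esum_(i in [set: I]) (u i ^+ 2 * hnorm (orth_proj (U i) f) ^+ 2)%:E)%E.

Definition fusion_bessel (S : set H) (U : I -> set H) (u : I -> R) : Prop :=
  weighted_family S U u /\
  exists2 beta : R, 0 < beta &
    forall f, S f -> (frame_sum U u f <= (beta * hnorm f ^+ 2)%:E)%E.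

Definition fusion_frame (S : set H) (U : I -> set H) (u : I -> R) : Prop :=
  weighted_family S U u /\
  exists alpha beta : R, [/\ 0 < alpha, alpha <= beta &
    forall f, S f -> ((alpha * hnorm f ^+ 2)%:E <= frame_sum U u f /\
                      frame_sum U u f <= (beta * hnorm f ^+ 2)%:E)%E].

Definition synthesis (u : I -> R) (x : I -> H) : H :=
  summability.sum (fun i => of_real (u i) *: x i).

Definition analysis (U : I -> set H) (u : I -> R) : H -> (I -> H) :=
  adjoint (Kspace U) Hspace (synthesis u).

Definition image_family (A : H -> H) (U : I -> set H) : I -> set H :=
  fun i => A @` U i.

(* M_j and Q_{L,u}: the codomain of the latter is the Hilbert sum of the spaces
   L M_i K_U, supplied where its boundedness is stated. *)
Definition keep (j : I) (x : I -> H) : I -> H :=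
  fun i => if i == j then x i else 0.

Definition component_op (L : (I -> H) -> H) (u : I -> R) (x : I -> H) :
    I -> H :=
  fun i => (of_real (u i))^-1 *: L (keep i x).

(* (V, v), a fusion frame for SV, as a dual of (W, w), a fusion frame for SW. *)
Definition approx_oblique_dual (eps : R) (SW : set H) (W : I -> set H)
    (w : I -> R) (SV : set H) (V : I -> set H) (v : I -> R)
    (Q : (I -> H) -> (I -> H)) : Prop :=
  [/\ 0 <= eps, fusion_frame SW W w, fusion_frame SV V v,
      bounded_operator (Kspace W) (Kspace V) Q
    & (opnorm Hspace Hspace (fun f : H =>
         (synthesis v (Q (analysis W w f)) - oblique_proj SV (orth SW) f)%R)
       <= eps%:E)%E].

Definition oblique_dual (SW : set H) (W : I -> set H) (w : I -> R)
    (SV : set H) (V : I -> set H) (v : I -> R) (Q : (I -> H) -> (I -> H)) :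
    Prop :=
  approx_oblique_dual 0 SW W w SV V v Q.

End fusion.

Arguments Hspace {R k H} dot.
Arguments Kspace {R k H} dot {I} U.
Arguments synthesis {R k H I} u x.
Arguments analysis {R k H} dot {I} U u.
Arguments component_op {R k H I} L u x.
Arguments fusion_frame {R k H} dot {I} S U u.
Arguments fusion_bessel {R k H} dot {I} S U u.
Arguments approx_oblique_dual {R k H} dot {I} eps SW W w SV V v Q.
Arguments oblique_dual {R k H} dot {I} SW W w SV V v Q.

(* Main.v *)
Require Import Defs.
From HB Require Import structures.
From mathcomp Require Import all_boot all_order all_algebra finmap.
From mathcomp Require Import complex.
From mathcomp Require Import all_classical all_reals all_analysis.
From mathcomp Require summability.
From mathcomp Require Import ring lra.

Set Implicit Arguments.
Unset Strict Implicit.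
Unset Printing Implicit Defensive.

Import Order.TTheory GRing.Theory Num.Theory.
Import numFieldNormedType.Exports.

Local Open Scope classical_set_scope.
Local Open Scope ring_scope.

(** Let p be the projection onto SV along the orthogonal of SW, and let
    S = T_V Q T_W*, so that D = p - S has norm at most eps < 1 and A is the inverse
    of 1 - D, given by the Neumann series ([neumann_series]).  Two identities carry
    the proof.

    - A S = p.  On the orthogonal of SW both p and T_W* vanish, hence so does D and
      A is the identity there; apply A to S f = (f - D f) - (f - p f).
    - S A = p.  The values of D lie in SV, so (1 - p) D = 0, and A f = f + D (A f)
      gives p (A f) = p f + D (A f), that is S (A f) = p (A f) - D (A f) = p f.

    The weights of Q_(A T_V) cancel against those of the synthesis operator of AV:
    T_AV Q_(A T_V) = A T_V ([synthesis_component_op]), and likewise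
    T_(A*W) Q_(A* T_W) = A* T_W.  Thus T_AV Q_(A T_V) Q T_W* = A S = p, which is
    (i).  For (ii), T_(A*W) Q_(A* T_W) Q* T_V* = A* T_W Q* T_V* is the adjoint of
    S A = p, that is, the projection onto SW along the orthogonal of SV.  For (iii),
    taking adjoints in the second cancellation gives
    Q_(A* T_W)* T_(A*W)* = T_W* A, so the operator under study is A S A = p A, and
    p A - p = D A has norm at most eps / (1 - eps).

    In (i) and (ii) only the upper frame inequalities are assumed for the new
    families; the lower ones follow because a bounded right inverse L of a
    synthesis operator T gives |f|^2 = <L f, T* f> <= |L| |f| |T* f|
    ([fusion_frame_right_inverse]).

    All adjoints come from one lemma ([adjointP]): an operator has an adjoint as
    soon as bounded functionals on its source are inner products.  For closed
    subspaces of H this is the Riesz theorem ([Riesz]); for a direct sum it is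
    deduced componentwise ([Kspace_representable]). *)

#[local] Existing Instance summability.totally_filter.
#[local] Notation totally := summability.totally.
#[local] Notation partial_sum := summability.partial_sum.

(** * Scalars *)

Section scalars.
Variables (R : realType) (k : scalar_kind).
Local Notation K := (RorC R k).
Local Notation rl := (@of_real R k).
Local Notation conj := (conj_scalar R k).
Implicit Types (r s : R) (a b : K).

Lemma of_real_is_zmod_morphism : zmod_morphism rl.
Proof. by case: k => // r s /=; rewrite -[RHS](rmorphB (real_complex R)). Qed.

Lemma of_real_is_monoid_morphism : monoid_morphism rl.
Proof.
case: k; split => //= r s.
by rewrite -[RHS](rmorphM (real_complex R)).
Qed.

HB.instance Definition _ := GRing.isZmodMorphism.Build R K rl
  of_real_is_zmod_morphism.
HB.instance Definition _ := GRing.isMonoidMorphism.Build R K rl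
  of_real_is_monoid_morphism.

Lemma re_is_zmod_morphism : zmod_morphism (@re R k).
Proof. by case: k => // -[a b] [c d]. Qed.

HB.instance Definition _ := GRing.isZmodMorphism.Build K R (@re R k)
  re_is_zmod_morphism.

Lemma conj_is_zmod_morphism : zmod_morphism conj.
Proof. by case: k => // a b; exact: (rmorphB (@conjc R)). Qed.

Lemma conj_is_monoid_morphism : monoid_morphism conj.
Proof.
case: k; split => //=; first exact: (rmorph1 (@conjc R)).
exact: (rmorphM (@conjc R)).
Qed.

HB.instance Definition _ := GRing.isZmodMorphism.Build K K conj
  conj_is_zmod_morphism.
HB.instance Definition _ := GRing.isMonoidMorphism.Build K K conj
  conj_is_monoid_morphism.

Lemma of_realK r : re (rl r) = r. Proof. by case: k. Qed.

Lemma re_mulr r a : re (rl r * a) = r * re a.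
Proof. by case: k a => // -[a b] /=; rewrite mul0r subr0. Qed.

Lemma re_conj a : re (conj a) = re a.
Proof. by case: k a => // -[]. Qed.

Lemma conj_scalarK : involutive conj.
Proof. by case: k => // a; exact: conjcK. Qed.

Lemma conj_of_real r : conj (rl r) = rl r.
Proof. by case: k => //=; rewrite oppr0. Qed.

Lemma ler_of_real r s : (rl r <= rl s) = (r <= s).
Proof. by case: k => //=; exact: lecR. Qed.

Lemma ltr_of_real r s : (rl r < rl s) = (r < s).
Proof. by case: k => //=; exact: ltcR. Qed.

Lemma re_le a b : a <= b -> re a <= re b.
Proof. by case: k a b => //= a b; rewrite lecE => /andP[]. Qed.

Lemma ge0_of_real a : 0 <= a -> a = rl (re a).
Proof.
by case: k a => // -[a b]; rewrite lecE /= => /andP[/eqP-> _].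
Qed.

Lemma mulcj a : conj a * a = `|a| ^+ 2.
Proof.
case: k a => /= a; first by rewrite real_normK ?num_real// expr2.
by rewrite sqr_normc mulrC.
Qed.

Lemma norm_of_real r : `|rl r| = rl `|r|.
Proof.
by case: k => //=; rewrite normc_def/= expr0n addr0 sqrtr_sqr.
Qed.

Lemma abs_re_le a : rl `|re a| <= `|a|.
Proof. by case: k a => // a; exact: normc_ge_Re. Qed.

Lemma re_le_norm a : re a <= re `|a|.
Proof.
by have := re_le (abs_re_le a); rewrite of_realK; apply: le_trans; exact: ler_norm.
Qed.

Lemma re_norm_ge0 (V : normedZmodType K) (x : V) : 0 <= re `|x|.
Proof. by have := re_le (normr_ge0 x); rewrite raddf0. Qed.

(** The multiple by the conjugate of a is |a|^2. *)
Lemma re_mul_eq0 a : (forall b, re (b * a) <= 0) -> a = 0.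
Proof.
move=> /(_ (conj a)); rewrite mulcj.
have n0 : 0 <= `|a| ^+ 2 by rewrite exprn_ge0.
move=> h; have := re_le n0; rewrite raddf0 => h'.
have : re (`|a| ^+ 2) = 0 by apply/eqP; rewrite eq_le h h'.
move=> e; apply/eqP; rewrite -normr_eq0 -sqrf_eq0 (ge0_of_real n0) e.
by rewrite rmorph0.
Qed.

End scalars.

(** * Inner product spaces and adjoints *)

Section inner_product_spaces.
Variables (R : realType) (k : scalar_kind).
Local Notation K := (RorC R k).
Local Notation rl := (@of_real R k).
Local Notation conj := (conj_scalar R k).

(** The laws are required on the domain only, since the inner product of a
    direct sum means nothing outside the square-summable families. *)
Record pre_hilbert (X : ip_space R k) : Prop := PreHilbert {
  dom0 : dom X 0;
  domP : forall (a : K) x y, dom X x -> dom X y -> dom X (a *: x + y);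
  ipP : forall (a : K) x y z, dom X x -> dom X y -> dom X z ->
    ip (a *: x + y) z = a * ip x z + ip y z;
  ipC : forall x y, dom X x -> dom X y -> ip x y = conj (ip y x);
  ip_ge0 : forall x, dom X x -> 0 <= ip x x;
  ip_eq0 : forall x, dom X x -> ip x x = 0 -> x = 0 }.

Section theory.
Variables (X : ip_space R k) (pX : pre_hilbert X).
Implicit Types (x y z : car X) (a : K) (r : R).

Lemma domD x y : dom X x -> dom X y -> dom X (x + y).
Proof. by rewrite -[x in x + y]scale1r; exact: domP. Qed.

Lemma domZ a x : dom X x -> dom X (a *: x).
Proof. by move=> dx; rewrite -[_ *: _]addr0; apply: domP => //; exact: dom0. Qed.

Lemma domB x y : dom X x -> dom X y -> dom X (x - y).
Proof. by move=> dx dy; rewrite -scaleN1r; apply: domD => //; exact: domZ. Qed.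

Lemma dom_sum (J : Type) (s : seq J) (F : J -> car X) :
  (forall j, dom X (F j)) -> dom X (\sum_(j <- s) F j).
Proof.
move=> dF; elim/big_rec: _ => [|j x _ dx]; first exact: dom0.
exact: domD.
Qed.

Lemma ipDl x y z : dom X x -> dom X y -> dom X z ->
  ip (x + y) z = ip x z + ip y z.
Proof. by move=> *; rewrite -[x in x + y]scale1r ipP// mul1r. Qed.

Lemma ip0l z : dom X z -> ip 0 z = 0.
Proof.
move=> dz; have := ipDl (dom0 pX) (dom0 pX) dz.
by rewrite addr0 -[X in X = _]addr0 => /addrI.
Qed.

Lemma ipZl a x z : dom X x -> dom X z -> ip (a *: x) z = a * ip x z.
Proof. by move=> *; rewrite -[_ *: _]addr0 ipP ?ip0l ?addr0//; exact: dom0. Qed.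

Lemma ipDr x y z : dom X x -> dom X y -> dom X z ->
  ip x (y + z) = ip x y + ip x z.
Proof.
move=> dx dy dz; have dyz := domD dy dz.
by rewrite (ipC pX dx dyz) ipDl// rmorphD /= -(ipC pX dx dy) -(ipC pX dx dz).
Qed.

Lemma ipZr a x y : dom X x -> dom X y -> ip x (a *: y) = conj a * ip x y.
Proof.
move=> dx dy; have day := domZ a dy.
by rewrite (ipC pX dx day) ipZl// rmorphM /= -(ipC pX dx dy).
Qed.

Lemma ipBr x y z : dom X x -> dom X y -> dom X z ->
  ip x (y - z) = ip x y - ip x z.
Proof.
move=> *; rewrite -scaleN1r ipDr ?ipZr ?rmorphN1 ?mulN1r//; exact: domZ.
Qed.

Lemma re_ipC x y : dom X x -> dom X y -> re (ip x y) = re (ip y x).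
Proof. by move=> dx dy; rewrite (ipC pX dx dy) re_conj. Qed.

Lemma norm_ge0 x : 0 <= norm X x. Proof. exact: sqrtr_ge0. Qed.

Lemma re_ip_ge0 x : dom X x -> 0 <= re (ip x x).
Proof. by move=> dx; have := re_le (ip_ge0 pX dx); rewrite raddf0. Qed.

Lemma norm_sq x : dom X x -> norm X x ^+ 2 = re (ip x x).
Proof. by move=> dx; rewrite sqr_sqrtr// re_ip_ge0. Qed.

Lemma ip_norm x : dom X x -> ip x x = rl (norm X x ^+ 2).
Proof. by move=> dx; rewrite norm_sq// -ge0_of_real// ip_ge0. Qed.

Lemma norm0 : norm X 0 = 0.
Proof.
apply/eqP; rewrite -sqrf_eq0 norm_sq; last exact: dom0.
by rewrite ip0l ?raddf0//; exact: dom0.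
Qed.

Lemma norm_eq0 x : dom X x -> norm X x = 0 -> x = 0.
Proof.
by move=> dx n0; apply: ip_eq0 => //; rewrite ip_norm// n0 expr0n rmorph0.
Qed.

Lemma normZ a x : dom X x -> norm X (a *: x) = re `|a| * norm X x.
Proof.
move=> dx; have dax := domZ a dx.
apply/eqP; rewrite -(eqrXn2 (n := 2))// ?mulr_ge0 ?norm_ge0 ?re_norm_ge0//.
rewrite norm_sq// ipZl// ipZr// mulrA [a * _]mulrC mulcj ip_norm//.
rewrite (@ge0_of_real _ _ `|a|)// -rmorphXn -rmorphM of_realK exprMn.
by rewrite /= of_realK.
Qed.

Lemma norm_realZ r x : dom X x -> norm X (rl r *: x) = `|r| * norm X x.
Proof. by move=> dx; rewrite normZ// norm_of_real of_realK. Qed.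

Lemma norm_sqD x y : dom X x -> dom X y ->
  norm X (x + y) ^+ 2 = norm X x ^+ 2 + 2 * re (ip x y) + norm X y ^+ 2.
Proof.
move=> dx dy; have dxy := domD dx dy.
rewrite !norm_sq// ipDl// !ipDr// !raddfD /= (re_ipC dy dx).
ring.
Qed.

Lemma norm_sqB x y : dom X x -> dom X y ->
  norm X (x - y) ^+ 2 = norm X x ^+ 2 - 2 * re (ip x y) + norm X y ^+ 2.
Proof.
move=> dx dy; have dy' := domZ (-1) dy.
rewrite -scaleN1r norm_sqD// ipZr// rmorphN1 mulN1r raddfN /= mulrN.
by rewrite (normZ _ dy) normrN1 -(rmorph1 rl) of_realK mul1r.
Qed.

Lemma norm_sub x y : dom X x -> dom X y -> norm X (x - y) = norm X (y - x).
Proof.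
move=> dx dy; rewrite -opprB -(scaleN1r (y - x)) (normZ _ (domB dy dx)).
by rewrite normrN1 -(rmorph1 rl) of_realK mul1r.
Qed.

(** The polynomial t |-> |x - t <x, y> y|^2 is nonnegative; evaluate it at
    t = 1 / |y|^2, or far away when |y| = 0. *)
Lemma Cauchy_Schwarz x y : dom X x -> dom X y ->
  re `|ip x y| <= norm X x * norm X y.
Proof.
move=> dx dy; set c := ip x y; set a := norm X x; set b := norm X y.
have a0 : 0 <= a by exact: norm_ge0.
have b0 : 0 <= b by exact: norm_ge0.
have n0 : 0 <= re `|c| by exact: re_norm_ge0.
rewrite -(ler_pXn2r (n := 2))// ?nnegrE ?mulr_ge0// exprMn.
set n := re `|c| ^+ 2.
have cn : conj c * c = rl n by rewrite mulcj (@ge0_of_real _ _ `|c|)// rmorphXn.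
have quad (t : R) : 0 <= a ^+ 2 - 2 * t * n + t ^+ 2 * n * b ^+ 2.
  have dcy := domZ (rl t * c) dy.
  have : 0 <= norm X (x - (rl t * c) *: y) ^+ 2 by rewrite exprn_ge0// norm_ge0.
  rewrite norm_sqB// ipZr// rmorphM/= conj_of_real -mulrA cn -rmorphM of_realK.
  rewrite normZ// normrM norm_of_real re_mulr exprMn.
  rewrite exprMn real_normK ?num_real//= -/n -/a -/b.
  by rewrite (mulrA 2).
have [n_eq0|n_neq0] := eqVneq n 0; first by rewrite n_eq0 mulr_ge0 ?exprn_ge0.
have n_gt0 : 0 < n by rewrite lt_def n_neq0 exprn_ge0.
have [b_eq0|b_neq0] := eqVneq b 0.
  have := quad ((a ^+ 2 + 1) / n).
  rewrite b_eq0 expr0n mulr0 addr0 -mulrA divfK//.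
  have := sqr_ge0 a; lra.
have b2 : 0 < b ^+ 2 by rewrite exprn_gt0// lt_def b_neq0.
have := quad (b ^+ 2)^-1.
rewrite (_ : _ + _ = a ^+ 2 - n / b ^+ 2); last by field.
by rewrite subr_ge0 ler_pdivrMr.
Qed.

Lemma re_Cauchy_Schwarz x y : dom X x -> dom X y ->
  re (ip x y) <= norm X x * norm X y.
Proof.
by move=> dx dy; apply: le_trans (Cauchy_Schwarz dx dy); exact: re_le_norm.
Qed.

Lemma norm_triangle x y : dom X x -> dom X y ->
  norm X (x + y) <= norm X x + norm X y.
Proof.
move=> dx dy; rewrite -(ler_pXn2r (n := 2))// ?nnegrE ?addr_ge0 ?norm_ge0//.
rewrite norm_sqD// sqrrD.
have := re_Cauchy_Schwarz dx dy; lra.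
Qed.

Lemma ip_inj y z : dom X y -> dom X z ->
  (forall x, dom X x -> ip x y = ip x z) -> y = z.
Proof.
move=> dy dz h; apply/eqP; rewrite -subr_eq0; apply/eqP.
have dyz := domB dy dz.
by apply: ip_eq0 => //; rewrite ipBr// h// subrr.
Qed.

End theory.

(** Bounding the real part bounds the modulus, by homogeneity. *)
Definition bounded_functional (X : ip_space R k) (phi : car X -> K) : Prop :=
  (forall (a : K) x y, dom X x -> dom X y ->
     phi (a *: x + y) = a * phi x + phi y) /\
  exists C : R, forall x, dom X x -> re (phi x) <= C * norm X x.

Definition representable (X : ip_space R k) : Prop :=
  forall phi, bounded_functional phi ->
    exists2 z, dom X z & forall x, dom X x -> phi x = ip x z.

Lemma functional0 (X : ip_space R k) (phi : car X -> K) : pre_hilbert X ->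
  bounded_functional phi -> phi 0 = 0.
Proof.
move=> pX [lphi _]; have := lphi 1 0 0 (dom0 pX) (dom0 pX).
by rewrite scale1r addr0 mul1r -[X in X = _]addr0 => /addrI.
Qed.

(** Nonpositive real parts suffice: x may be multiplied by any scalar. *)
Lemma functional_eq0 (X : ip_space R k) (phi : car X -> K) : pre_hilbert X ->
  bounded_functional phi ->
  (forall x, dom X x -> re (phi x) <= 0) -> forall x, dom X x -> phi x = 0.
Proof.
move=> pX bphi h x dx; have [lphi _] := bphi; apply: re_mul_eq0 => b.
have d0 := dom0 pX; have phi0 := functional0 pX bphi.
rewrite (_ : b * phi x = phi (b *: x)); first by apply: h; exact: domZ.
by rewrite -[b *: x]addr0 lphi// phi0 addr0.
Qed.

Section operators.
Variables (X Y : ip_space R k).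
Hypotheses (pX : pre_hilbert X) (pY : pre_hilbert Y).
Variables (L : car X -> car Y) (bL : bounded_operator X Y L).

Lemma op_dom x : dom X x -> dom Y (L x). Proof. by case: bL => + _ _; apply. Qed.

Lemma opP (a : K) x y : dom X x -> dom X y -> L (a *: x + y) = a *: L x + L y.
Proof. by case: bL => _ + _; apply. Qed.

Lemma op0 : L 0 = 0.
Proof.
have := opP 1 (dom0 pX) (dom0 pX); rewrite !scale1r addr0.
by rewrite -[X in X = _]addr0 => /addrI.
Qed.

Lemma opD x y : dom X x -> dom X y -> L (x + y) = L x + L y.
Proof. by move=> *; rewrite -[x in x + y]scale1r opP// scale1r. Qed.

Lemma opZ (a : K) x : dom X x -> L (a *: x) = a *: L x.
Proof. by move=> *; rewrite -[_ *: x]addr0 opP ?op0 ?addr0//; exact: dom0. Qed.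

Lemma opB x y : dom X x -> dom X y -> L (x - y) = L x - L y.
Proof.
move=> dx dy; have dy' := domZ pX (-1) dy.
by rewrite -(scaleN1r y) opD// opZ// !scaleN1r.
Qed.

Lemma op_bound : exists2 C : R, 0 < C & forall x, dom X x ->
  norm Y (L x) <= C * norm X x.
Proof.
case: bL => _ _ [C hC]; exists (`|C| + 1); first by rewrite ltr_wpDl.
move=> x dx; apply: le_trans (hC x dx) _.
by rewrite ler_wpM2r ?norm_ge0// (le_trans (ler_norm C))// lerDl.
Qed.

Lemma op_functional y : dom Y y -> bounded_functional (fun x => ip (L x) y).
Proof.
move=> dy; split=> [a x x' dx dx'|].
  by rewrite opP// ipP//; exact: op_dom.
have [C C0 hC] := op_bound; exists (C * norm Y y) => x dx.
apply: le_trans (re_Cauchy_Schwarz pY (op_dom dx) dy) _.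
by rewrite mulrAC ler_wpM2r ?norm_ge0// hC.
Qed.

(** The norm of the adjoint is bounded by duality:
    |M y|^2 = <L (M y), y> <= C |M y| |y|. *)
Lemma adjointP : representable X -> is_adjoint X Y L (adjoint X Y L).
Proof.
move=> rX; suff ex : exists M, is_adjoint X Y L M.
  by rewrite /adjoint; case: xgetP => [M _ //|]; case: ex => M + /(_ M).
have /choice[M hM] (y : car Y) : exists z, dom Y y ->
    dom X z /\ forall x, dom X x -> ip (L x) y = ip x z.
  have [dy|ndy] := pselect (dom Y y); last by exists 0.
  by have [z dz hz] := rX _ (op_functional dy); exists z.
have dM y : dom Y y -> dom X (M y) by move=> /hM[].
have eM y x : dom Y y -> dom X x -> ip (L x) y = ip x (M y) by move=> /hM[_]; apply.
exists M; split; last by move=> x y dx dy; exact: eM.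
split=> // [a y y' dy dy'|].
  have day := domP pY a dy dy'.
  apply: (ip_inj pX) => [||x dx]; [exact: dM|exact: domP (dM _ _) (dM _ _)|].
  rewrite -eM// ipDr ?ipZr//; try exact: op_dom; last exact: domZ.
  rewrite ipDr ?ipZr//; try exact: dM; last by apply: domZ => //; exact: dM.
  by rewrite !eM.
have [C C0 hC] := op_bound; exists C => y dy.
have [->|n0] := eqVneq (norm X (M y)) 0; first by rewrite mulr_ge0 ?norm_ge0// ltW.
have n_gt0 : 0 < norm X (M y) by rewrite lt_def n0 norm_ge0.
rewrite -(ler_pM2r n_gt0) -expr2 (norm_sq pX (dM _ dy)).
rewrite -(eM _ _ dy (dM _ dy)).
apply: le_trans (re_Cauchy_Schwarz pY (op_dom (dM _ dy)) dy) _.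
by rewrite mulrAC ler_wpM2r ?norm_ge0//; exact/hC/dM.
Qed.

End operators.

Lemma bounded_operator_comp (X Y Z : ip_space R k) (pX : pre_hilbert X)
    (pY : pre_hilbert Y) (L : car X -> car Y) (M : car Y -> car Z) :
  bounded_operator X Y L -> bounded_operator Y Z M ->
  bounded_operator X Z (M \o L).
Proof.
move=> bL bM; split=> /= [x dx|a x y dx dy|].
- exact: op_dom bM _ (op_dom bL dx).
- by rewrite (opP bL)// (opP bM)//; exact: op_dom.
have [C C0 hC] := op_bound bL; have [C' C'0 hC'] := op_bound bM.
exists (C' * C) => x dx; apply: le_trans (hC' _ (op_dom bL dx)) _.
by rewrite -mulrA ler_wpM2l ?hC// ltW.
Qed.

Lemma opnorm_le (X Y : ip_space R k) (L : car X -> car Y) (e : R) : 0 <= e ->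
  (forall x, dom X x -> norm Y (L x) <= e * norm X x) ->
  (opnorm X Y L <= e%:E)%E.
Proof.
move=> e0 h; apply: ge_ereal_sup => _ [x [dx nx] <-]; rewrite lee_fin.
by apply: le_trans (h x dx) _; rewrite -[leRHS]mulr1 ler_wpM2l.
Qed.

Lemma le_opnorm (X Y : ip_space R k) (pX : pre_hilbert X)
    (pY : pre_hilbert Y) (L : car X -> car Y) (e : R) :
  (forall x, dom X x -> dom Y (L x)) ->
  (forall (a : K) x, dom X x -> L (a *: x) = a *: L x) ->
  (opnorm X Y L <= e%:E)%E ->
  forall x, dom X x -> norm Y (L x) <= e * norm X x.
Proof.
move=> dL hL h x dx; have [x0|x_neq0] := eqVneq (norm X x) 0.
  rewrite x0 mulr0 (norm_eq0 pX dx x0) -(scale0r 0) hL ?scale0r ?norm0//.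
  exact: dom0.
have x_gt0 : 0 < norm X x by rewrite lt_def x_neq0 norm_ge0.
rewrite -ler_pdivrMr// -lee_fin; apply: le_trans h.
apply: ereal_sup_ubound; exists (rl (norm X x)^-1 *: x); last first.
  by rewrite hL// (norm_realZ pY _ (dL _ dx)) ger0_norm ?invr_ge0 ?norm_ge0// mulrC.
split; first exact: domZ.
by rewrite (norm_realZ pX _ dx) ger0_norm ?invr_ge0 ?norm_ge0//= mulVf.
Qed.

End inner_product_spaces.

(** * Limits and the Riesz representation theorem *)

Section limits.
Variables (R : realType) (k : scalar_kind) (V : normedModType (RorC R k)).
Local Notation K := (RorC R k).
Local Notation rl := (@of_real R k).

Lemma of_real_norm (x : V) : rl (re `|x|) = `|x|.
Proof. by rewrite -ge0_of_real. Qed.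

Lemma gt0_of_real (e : K) : 0 < e -> exists2 r : R, 0 < r & e = rl r.
Proof.
move=> e0; exists (re e); last by rewrite -ge0_of_real// ltW.
by rewrite -(@ltr_of_real _ k) rmorph0 -ge0_of_real// ltW.
Qed.

Lemma cvg_re_dist (T : Type) (F : set_system T) {FF : Filter F} (f : T -> V)
    (l : V) :
  f @ F --> l <->
  forall e : R, 0 < e -> \forall t \near F, re `|l - f t| <= e.
Proof.
split=> [/cvgrPdist_le h e e0|h].
  have /h : 0 < rl e by rewrite -(rmorph0 rl) ltr_of_real.
  by apply: filterS => t; rewrite -[leLHS]of_real_norm ler_of_real.
apply/cvgrPdist_le => e /gt0_of_real[r r0 ->].
by apply: filterS (h r r0) => t ht; rewrite -of_real_norm ler_of_real.
Qed.


End limits.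

Section bounded_maps.
Variables (R : realType) (k : scalar_kind) (V W : normedModType (RorC R k)).

Lemma cvg_dist_bound (T : Type) (F : set_system T) {FF : Filter F}
    (f : T -> V) (l : V) (g : T -> W) (m : W) (C : R) :
  (forall t, re `|m - g t| <= C * re `|l - f t|) -> f @ F --> l -> g @ F --> m.
Proof.
move=> h /cvg_re_dist hf; apply/cvg_re_dist => r r0.
have C0 : 0 < `|C| + 1 by rewrite ltr_wpDl.
apply: filterS (hf (r / (`|C| + 1)) (divr_gt0 r0 C0)) => t.
rewrite ler_pdivlMr// => ht; apply: le_trans ht; apply: le_trans (h t) _.
rewrite mulrC ler_wpM2l ?re_norm_ge0//.
by rewrite (le_trans (ler_norm C))// lerDl.
Qed.

Lemma le_of_cvg (T : Type) (F : set_system T) {FF : ProperFilter F}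
    (f : T -> V) (l : V) (M : R) :
  f @ F --> l -> (\forall t \near F, re `|f t| <= M) -> re `|l| <= M.
Proof.
move=> /cvg_re_dist hf hM; apply/ler_addgt0Pr => e e0.
have [t [h1 h2]] := filter_ex (filterI (hf e e0) hM).
rewrite -(@ler_of_real _ k) rmorphD !of_real_norm.
rewrite -[l](subrK (f t)); apply: le_trans (ler_normD _ _) _.
by rewrite addrC lerD// -of_real_norm ler_of_real.
Qed.

End bounded_maps.

Section hilbert_space.
Variables (R : realType) (k : scalar_kind).
Local Notation K := (RorC R k).
Local Notation rl := (@of_real R k).
Variables (H : completeNormedModType K) (dot : {dot H for @conj_scalar R k}).
Hypothesis dot_norm : forall x : H, dot x x = `|x| ^+ 2.
Local Notation hn := (hnorm dot).

Lemma dotC (x y : H) : dot x y = conj_scalar R k (dot y x).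
Proof. by rewrite (hermitian_subproof x y) expr0 mul1r. Qed.

Lemma hnormE (x : H) : hn x = re `|x|.
Proof.
rewrite /hnorm /norm /= dot_norm -[in LHS]of_real_norm -rmorphXn /= of_realK.
by rewrite sqrtr_sqr ger0_norm// re_norm_ge0.
Qed.

Lemma subspace_pre_hilbert (U : set H) : U 0 ->
  (forall (a : K) x y, U x -> U y -> U (a *: x + y)) ->
  pre_hilbert (IpSpace U dot).
Proof.
move=> U0 UP; split=> //= [a x y z _ _ _|x y _ _|x _|x _ /eqP].
- by rewrite linearPl.
- exact: dotC.
- by rewrite dot_norm exprn_ge0.
- by rewrite dot_norm sqrf_eq0 normr_eq0 => /eqP.
Qed.

Lemma Hspace_pre_hilbert : pre_hilbert (Hspace dot).
Proof. exact: subspace_pre_hilbert. Qed.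
Local Notation pH := Hspace_pre_hilbert.

Lemma closed_subspace_pre_hilbert (U : set H) : closed_subspace U ->
  pre_hilbert (IpSpace U dot).
Proof. by case=> U0 UP _; exact: subspace_pre_hilbert. Qed.

Lemma cvg_hnorm (T : Type) (F : set_system T) {FF : Filter F} (f : T -> H)
    (l : H) :
  f @ F --> l <-> forall e : R, 0 < e -> \forall t \near F, hn (l - f t) <= e.
Proof.
by rewrite cvg_re_dist; split=> h e e0; apply: filterS (h e e0) => t;
  rewrite hnormE.
Qed.

Lemma cauchy_cvg_hnorm (T : Type) (F : set_system T) {FF : ProperFilter F}
    (f : T -> H) :
  (forall e : R, 0 < e -> exists x, \forall t \near F, hn (x - f t) <= e) ->
  cvg (f @ F).
Proof.
move=> h; apply: cauchy_cvg; apply: cauchy_exP => e /gt0_of_real[r r0 ->].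
have r20 : 0 < r / 2 by rewrite divr_gt0.
have [x hx] := h _ r20; exists x; apply: filterS hx => t ht.
rewrite /= -ball_normE /ball_ /= -of_real_norm ltr_of_real -hnormE.
by apply: le_lt_trans ht _; rewrite ltr_pdivrMr// ltr_pMr// ltr1n.
Qed.

Lemma hnorm_le_of_cvg (T : Type) (F : set_system T) {FF : ProperFilter F}
    (f : T -> H) (l : H) (M : R) :
  f @ F --> l -> (\forall t \near F, hn (f t) <= M) -> hn l <= M.
Proof.
move=> hf hM; rewrite hnormE; apply: le_of_cvg hf _.
by apply: filterS hM => t; rewrite hnormE.
Qed.

Lemma cvg_dot (T : Type) (F : set_system T) {FF : Filter F} (f : T -> H)
    (l y : H) :
  f @ F --> l -> (fun t => dot (f t) y : K^o) @ F --> (dot l y : K^o).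
Proof.
apply: cvg_dist_bound (hn y) _ => t; rewrite -linearBl mulrC -hnormE.
exact: (Cauchy_Schwarz pH).
Qed.

Lemma closed_subspace_cvg (U : set H) (T : Type) (F : set_system T)
    {FF : ProperFilter F} (f : T -> H) (l : H) :
  closed_subspace U -> (forall t, U (f t)) -> f @ F --> l -> U l.
Proof.
by case=> _ _ clU Uf hf; apply: (closed_cvg U) hf => //; exact: nearW.
Qed.

Lemma quad_ge0_eq0 (a b : R) : 0 <= a ->
  (forall t, 0 <= t ^+ 2 * a + 2 * t * b) -> b = 0.
Proof.
move=> a0 /(_ (- b / (a + 1))).
have a1 : 0 < a + 1 by rewrite ltr_wpDl.
have a1' : a + 1 != 0 by rewrite gt_eqF.
rewrite (_ : _ + _ = - ((b / (a + 1)) ^+ 2 * (a + 2))); last by field.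
rewrite oppr_ge0 pmulr_lle0; last by rewrite ltr_wpDl.
have := sqr_ge0 (b / (a + 1)) => /[swap] h1 h2.
have /eqP : (b / (a + 1)) ^+ 2 = 0 by apply/eqP; rewrite eq_le h1 h2.
by rewrite sqrf_eq0 mulf_eq0 invr_eq0 (negbTE a1') orbF => /eqP.
Qed.

(** The vector representing phi minimises |x|^2 - 2 Re phi(x).  A minimising
    sequence is Cauchy by the parallelogram law, and perturbing it in a direction z
    shows that its limit u satisfies Re <z, u> = Re phi(z). *)
Lemma Riesz (U : set H) : closed_subspace U -> representable (IpSpace U dot).
Proof.
move=> cU; have pU := closed_subspace_pre_hilbert cU.
move=> phi bphi; have [lphi [C hC]] := bphi; rewrite /= in lphi hC.
have phi0 := functional0 pU bphi.
have phiD x y : U x -> U y -> phi (x + y) = phi x + phi y.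
  by move=> Ux Uy; rewrite -[x in LHS]scale1r lphi// mul1r.
have phiZ (a : K) x : U x -> phi (a *: x) = a * phi x.
  by move=> Ux; rewrite -[_ *: x]addr0 lphi ?phi0 ?addr0//; exact: (dom0 pU).
pose J x := hn x ^+ 2 - 2 * re (phi x).
pose E := [set J x | x in U].
have J_ge x : U x -> - C ^+ 2 <= J x.
  move=> Ux; have hx : re (phi x) <= C * hn x by exact: hC.
  by have := sqr_ge0 (hn x - C); rewrite /J sqrrB; lra.
have infE : has_inf E.
  split; first by exists (J 0), 0 => //; exact: (dom0 pU).
  by exists (- C ^+ 2) => _ [x Ux <-]; exact: J_ge.
set d := inf E.
have J_ged x : U x -> d <= J x.
  by move=> Ux; apply: ge_inf; [case: infE|exists x].
have /choice[u hu] (n : nat) : exists x, U x /\ J x <= d + n.+1%:R^-1.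
  have e0 : 0 < n.+1%:R^-1 :> R by rewrite invr_gt0.
  by have [_ [x Ux <-] /ltW ?] := inf_adherent e0 infE; exists x.
have Uu n : U (u n) by case: (hu n).
have dist x y : U x -> U y -> hn (x - y) ^+ 2 <= 2 * (J x - d) + 2 * (J y - d).
  move=> Ux Uy; have Uxy : U (x + y) by exact: (domD pU).
  have /J_ged : U (rl 2^-1 *: (x + y)) by exact: (domZ pU).
  rewrite {1}/J phiZ// (phiD _ _ Ux Uy) re_mulr (raddfD (@re R k)) /=.
  rewrite /hnorm (@norm_realZ _ _ _ pH _ (x + y) I) exprMn.
  rewrite ger0_norm ?invr_ge0// (norm_sqD pH (x := x) (y := y))//.
  rewrite (norm_sqB pH (x := x) (y := y))// /J /hnorm; lra.
have cu : cvg (u @ \oo).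
  apply: cauchy_cvg_hnorm => e e0.
  have e20 : 0 < (e ^+ 2 / 4) by rewrite divr_gt0// exprn_gt0.
  have [N _ hN] := near_infty_natSinv_lt (PosNum e20).
  exists (u N); exists N => // n /= Nn.
  rewrite -(ler_pXn2r (n := 2))// ?nnegrE ?norm_ge0 ?(ltW e0)//.
  apply: le_trans (dist _ _ (Uu N) (Uu n)) _.
  have := hN N (leqnn _); have := hN n Nn; rewrite /=.
  have [_] := hu N; have [_] := hu n.
  move: (J _) (J _) (n.+1%:R^-1) (N.+1%:R^-1) (e ^+ 2) => ? ? ? ? ?; lra.
set l := lim (u @ \oo).
have Ul : U l by apply: closed_subspace_cvg cU Uu cu.
exists l => // x Ux; apply/eqP; rewrite -subr_eq0; apply/eqP; move: x Ux.
have bdiff : bounded_functional (X := IpSpace U dot)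
    (fun x => phi x - dot x l).
  split=> [a x y /= Ux Uy|].
    by rewrite lphi// linearPl opprD addrACA mulrBr.
  exists (C + hn l) => x /= Ux.
  rewrite raddfB /= mulrDl; apply: lerD; first exact: hC.
  rewrite -raddfN /= -linearNr mulrC.
  apply: le_trans (re_Cauchy_Schwarz pH _ _) _ => //.
  by rewrite -scaleN1r (normZ pH)// normrN1 -(rmorph1 rl) of_realK mul1r.
apply: (functional_eq0 pU bdiff) => z /= Uz.
suff /eqP : re (dot z l) - re (phi z) = 0.
  by rewrite subr_eq0 raddfB /= => /eqP ->; rewrite subrr.
apply: (@quad_ge0_eq0 (hn z ^+ 2)); first by rewrite exprn_ge0// norm_ge0.
move=> t; apply/ler_addgt0Pr => e e0.
pose D := 1 + 2 * `|t| * hn z.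
have D0 : 0 < D by rewrite ltr_pwDl// !mulr_ge0 ?norm_ge0.
have eD : 0 < e / D by rewrite divr_gt0.
have [N1 _ h1] := near_infty_natSinv_lt (PosNum eD).
have [N2 _ h2] := (cvg_hnorm _ _).1 cu _ eD.
pose n := maxn N1 N2.
have /ltW {}h1 := h1 n (leq_maxl _ _); have {}h2 := h2 n (leq_maxr _ _).
rewrite /= in h1 h2.
have Utz : U (rl t *: z) by exact: (domZ pU).
have := J_ged _ (domD pU (Uu n) Utz); have [_] := hu n.
rewrite /J (phiD _ _ (Uu n) Utz) phiZ// (raddfD (@re R k)) /= re_mulr.
rewrite (norm_sqD pH (x := u n) (y := rl t *: z))//.
rewrite (@norm_realZ _ _ _ pH _ z I) exprMn real_normK ?num_real//.
rewrite (ipZr pH _ (x := u n) (y := z))// conj_of_real re_mulr.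
have : re (dot (rl t *: (u n - l)) z) <= `|t| * (e / D) * hn z.
  apply: le_trans (re_Cauchy_Schwarz pH _ _) _ => //.
  rewrite ler_wpM2r ?norm_ge0// (@norm_realZ _ _ _ pH _ (u n - l) I).
  by rewrite ler_wpM2l// (norm_sub pH).
rewrite linearZl_LR linearBl re_mulr (raddfB (@re R k)) /=.
rewrite (re_ipC pH (x := z) (y := l))//.
have eDE : e = e / D + 2 * (`|t| * (e / D) * hn z).
  by rewrite /D; field; rewrite -/D gt_eqF.
rewrite -/(hn z) [in X in _ -> _ -> X]eDE.
rewrite -/(hn (u n)) -[@ip _ _ (Hspace dot) l z]/(dot l z); move: h1.
move: (hn (u n)) (`|t| * (e / D) * hn z) (e / D) (n.+1%:R^-1) => ? ? ? ?.
move: (re (dot (u n) z)) (re (dot l z)) => ? ?.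
move: (re (phi (u n))) (re (phi z)) => ? ?; lra.
Qed.

End hilbert_space.

(** * Unconditional sums *)

Section unconditional_sums.
Variables (R : realType) (k : scalar_kind) (I : choiceType).
Local Notation K := (RorC R k).
Local Notation rl := (@of_real R k).
Implicit Types (A B F : {fset I}).

Lemma partial_sumE (V : zmodType) (x : I -> V) F :
  partial_sum x F = \sum_(i <- F) x i.
Proof. by rewrite /partial_sum (big_seq_fsetE _ _ predT). Qed.

Lemma near_totally F : \forall B \near totally, (F `<=` B)%fset.
Proof. by exists F. Qed.

Definition has_sum (V : normedModType K) (x : I -> V) (l : V) : Prop :=
  partial_sum x @ totally --> l.

Section normed.
Variable V : normedModType K.
Implicit Types (x y : I -> V) (l m : V).

Lemma has_sumE x l : has_sum x l -> summability.sum x = l.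
Proof. by move=> h; apply: cvg_lim h; exact: norm_hausdorff. Qed.

Lemma cvg_has_sum x : cvg (partial_sum x @ totally) ->
  has_sum x (summability.sum x).
Proof. by []. Qed.

Lemma has_sum_uniq x l m : has_sum x l -> has_sum x m -> l = m.
Proof. by move=> /has_sumE <- /has_sumE <-. Qed.

Lemma has_sumP (a : K) x y l m : has_sum x l -> has_sum y m ->
  has_sum (fun i => a *: x i + y i) (a *: l + m).
Proof.
move=> hx hy; rewrite /has_sum.
rewrite (_ : partial_sum _ = fun F => a *: partial_sum x F + partial_sum y F).
  by apply: cvgD => //; apply: cvgZr.
by apply/funext => F; rewrite !partial_sumE big_split/= scaler_sumr.
Qed.

Lemma has_sum_fset x F : (forall i, i \notin F -> x i = 0) ->
  has_sum x (\sum_(i <- F) x i).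
Proof.
move=> x0; apply: cvg_near_cst; apply: filterS (near_totally F) => B FB.
rewrite partial_sumE; apply/esym/big_fset_incl => // i _; exact: x0.
Qed.

Lemma has_sum0 : has_sum (fun=> 0 : V) 0.
Proof.
have := has_sum_fset (x := fun=> 0 : V) (F := fset0) (fun _ _ => erefl).
by rewrite big_seq_fset0.
Qed.

Lemma has_sumZ (a : K) x l : has_sum x l -> has_sum (fun i => a *: x i) (a *: l).
Proof.
move=> h; rewrite -[a *: l]addr0.
rewrite (_ : (fun i => _) = fun i => a *: x i + 0); last first.
  by apply/funext => i; rewrite addr0.
exact: has_sumP h has_sum0.
Qed.

End normed.

Section nonneg.
Variable a : I -> R.
Hypothesis a_ge0 : forall i, 0 <= a i.

Lemma le_fset_sum A B : (A `<=` B)%fset ->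
  \sum_(i <- A) a i <= \sum_(i <- B) a i.
Proof.
move=> AB; rewrite (big_fsetID _ (mem A) B) /=.
rewrite (_ : [fset x in B | x \in A]%fset = A) ?lerDl ?sumr_ge0//.
apply/fsetP => i; rewrite !inE /= andbC; case: (boolP (i \in A)) => //= iA.
exact: (fsubsetP AB).
Qed.

Definition bounded_sums : Prop :=
  exists M, forall F, \sum_(i <- F) a i <= M.

Definition sup_sum : R := sup [set \sum_(i <- F) a i | F in [set: {fset I}]].

Lemma sup_sum_le M : (forall F, \sum_(i <- F) a i <= M) -> sup_sum <= M.
Proof.
move=> h; apply: ge_sup; last by move=> _ [F _ <-].
by exists (\sum_(i <- fset0) a i), fset0.
Qed.

Hypothesis a_bd : bounded_sums.

Lemma sup_sum_has_sup :
  has_sup [set \sum_(i <- F) a i | F in [set: {fset I}]].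
Proof.
split; first by exists (\sum_(i <- fset0) a i), fset0.
by case: a_bd => M hM; exists M => _ [F _ <-].
Qed.

Lemma le_sup_sum F : \sum_(i <- F) a i <= sup_sum.
Proof. by apply: ub_le_sup; [case: sup_sum_has_sup|exists F]. Qed.

Lemma sup_sum_approx (e : R) : 0 < e ->
  exists F, sup_sum - e < \sum_(i <- F) a i.
Proof.
by move=> e0; have [_ [F _ <-] ?] := sup_adherent e0 sup_sum_has_sup; exists F.
Qed.

Lemma tail_sum (e : R) : 0 < e ->
  exists F, forall B, [disjoint F & B]%fset -> \sum_(i <- B) a i <= e.
Proof.
move=> /sup_sum_approx[F hF]; exists F => B FB.
have := le_sup_sum (F `|` B)%fset.
rewrite (big_fsetID _ (mem F)) /=.
rewrite (_ : [fset x in _ | x \in F]%fset = F); last first.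
  by apply/fsetP => i; rewrite !inE /=; case: (i \in F); rewrite ?andbF.
rewrite (_ : [fset x in _ | x \notin F]%fset = B); last first.
  apply/fsetP => i; rewrite !inE /=; case: (boolP (i \in F)) => //= iF.
    by rewrite ?andbF; apply/esym/negbTE; exact: (fdisjointP FB).
  by rewrite ?andbT.
lra.
Qed.

Lemma has_sum_of_real : has_sum (fun i => rl (a i) : K^o) (rl sup_sum).
Proof.
apply/cvg_re_dist => e /sup_sum_approx[F hF].
apply: filterS (near_totally F) => B FB.
rewrite partial_sumE -(rmorph_sum rl) -(rmorphB rl) norm_of_real of_realK.
rewrite ger0_norm ?subr_ge0 ?le_sup_sum//.
have := le_fset_sum FB; lra.
Qed.

Lemma esum_sup_sum : (\esum_(i in [set: I]) (a i)%:E)%E = sup_sum%:E.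
Proof.
have sumE (X : set I) : finite_set X ->
    (\sum_(i \in X) (a i)%:E)%E = (\sum_(i <- fset_set X) a i)%:E.
  by move=> finX; rewrite fsbig_finite//= sumEFin.
apply/eqP; rewrite eq_le; apply/andP; split.
  apply: ge_ereal_sup => _ [X [finX _] <-].
  by rewrite sumE// lee_fin le_sup_sum.
apply/lee_addgt0Pr => e /sup_sum_approx[F hF].
rewrite -leeBlDr//; apply: esum_ge; exists [set` F] => //.
by rewrite sumE// set_fsetK -EFinB lee_fin ltW.
Qed.

End nonneg.

Lemma esum_lty_bounded (a : I -> R) : (forall i, 0 <= a i) ->
  (\esum_(i in [set: I]) (a i)%:E < +oo)%E <-> bounded_sums a.
Proof.
move=> a0; split=> [fin|bd]; last by rewrite esum_sup_sum// ltry.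
have fn : (\esum_(i in [set: I]) (a i)%:E)%E \is a fin_num.
  by rewrite ge0_fin_numE//; apply: esum_ge0 => i _; rewrite lee_fin.
exists (fine (\esum_(i in [set: I]) (a i)%:E)%E) => F.
rewrite -lee_fin fineK//; apply: esum_ge; exists [set` F] => //.
by rewrite fsbig_finite//= set_fsetK sumEFin.
Qed.

Lemma esum_le_fin (a : I -> R) (M : R) : (forall i, 0 <= a i) ->
  (\esum_(i in [set: I]) (a i)%:E <= M%:E)%E <->
  forall F, \sum_(i <- F) a i <= M.
Proof.
move=> a0; split=> h.
  have bd : bounded_sums a by apply/(esum_lty_bounded a0)/(le_lt_trans h)/ltry.
  move=> F; apply: le_trans (le_sup_sum bd F) _.
  by rewrite -lee_fin -esum_sup_sum.
have bd : bounded_sums a by exists M.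
by rewrite esum_sup_sum// lee_fin sup_sum_le.
Qed.

End unconditional_sums.

Section hilbert_sums.
Variables (R : realType) (k : scalar_kind).
Local Notation K := (RorC R k).
Local Notation rl := (@of_real R k).
Variables (H : completeNormedModType K) (dot : {dot H for @conj_scalar R k}).
Hypothesis dot_norm : forall x : H, dot x x = `|x| ^+ 2.
Variable I : choiceType.
Local Notation hn := (hnorm dot).
Let pH := Hspace_pre_hilbert dot_norm.

(** Cauchy criterion: the net of finite partial sums is Cauchy as soon as the
    sums over the finite sets disjoint from some finite F are small. *)
Lemma has_sum_cauchy (x : I -> H) :
  (forall e : R, 0 < e -> exists F : {fset I}, forall B,
     [disjoint F & B]%fset -> hn (\sum_(i <- B) x i) <= e) ->
  has_sum x (summability.sum x).
Proof.
move=> h; apply: cvg_has_sum; apply: (cauchy_cvg_hnorm dot_norm) => e /h[F hF].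
exists (\sum_(i <- F) x i); apply: filterS (near_totally F) => B FB.
rewrite partial_sumE /hnorm (norm_sub pH)// (big_fsetID _ (mem F) B) /=.
rewrite (_ : [fset y in B | y \in F]%fset = F); last first.
  apply/fsetP => i; rewrite !inE /= andbC; case: (boolP (i \in F)) => //= iF.
  exact: (fsubsetP FB).
rewrite [X in X - _]addrC addrK; apply: hF; apply/fdisjointP => i iF.
by rewrite !inE /= iF andbF.
Qed.

Lemma has_sum_dot (x : I -> H) (l y : H) : has_sum x l ->
  has_sum (fun i => dot (x i) y : K^o) (dot l y : K^o).
Proof.
move=> /(cvg_dot dot_norm (y := y)); rewrite /has_sum.
rewrite (_ : partial_sum _ = fun F => dot (partial_sum x F) y : K^o)//.
by apply/funext => F; rewrite !partial_sumE linear_sumlz.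
Qed.

Lemma hnorm_sum (J : Type) (s : seq J) (x : J -> H) :
  hn (\sum_(j <- s) x j) <= \sum_(j <- s) hn (x j).
Proof.
elim/big_rec2: _ => [|j y z _ h]; first by rewrite /hnorm (norm0 pH).
by apply: le_trans (norm_triangle pH _ _) _ => //; rewrite lerD2l.
Qed.

(** The scalar field inherits completeness from H along a line: a scalar series
    converges as soon as its product with a nonzero vector does. *)
Lemma has_sum_scalar (a : I -> K) (b : I -> R) :
  bounded_sums b -> (forall i, re `|a i| <= b i) -> (exists e : H, e != 0) ->
  has_sum (fun i => a i : K^o) (summability.sum (fun i => a i : K^o)).
Proof.
move=> bd ab [e e0].
have hne : 0 < hn e.
  rewrite lt_def norm_ge0 andbT; apply: contra_neq e0.
  exact: (norm_eq0 pH).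
have /(has_sum_dot (y := e)) : has_sum (fun i => a i *: e)
    (summability.sum (fun i => a i *: e)).
  apply: has_sum_cauchy => r r0.
  have [F hF] := tail_sum bd (divr_gt0 r0 hne).
  exists F => B /hF; rewrite ler_pdivlMr//; apply: le_trans.
  apply: le_trans (hnorm_sum _ _) _; rewrite mulr_suml; apply: ler_sum => i _.
  by rewrite /hnorm (normZ pH)// ler_wpM2r ?norm_ge0//.
move=> h; have dee : dot e e != 0.
  by rewrite dot_norm sqrf_eq0 normr_eq0.
have := has_sumZ (V := K^o) (a := (dot e e)^-1) h.
rewrite (_ : (fun i => _ *: _) = (fun i => a i : K^o)).
  by move=> /cvgP; exact: cvg_has_sum.
by apply/funext => i; rewrite linearZl_LR /= [_ *: _]mulrC mulfK.
Qed.

End hilbert_sums.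

(** * The Hilbert direct sum of a family of closed subspaces *)

Section hilbert_direct_sum.
Variables (R : realType) (k : scalar_kind).
Local Notation K := (RorC R k).
Local Notation rl := (@of_real R k).
Variables (H : completeNormedModType K) (dot : {dot H for @conj_scalar R k}).
Hypothesis dot_norm : forall x : H, dot x x = `|x| ^+ 2.
Variable I : countType.
Local Notation hn := (hnorm dot).
Let pH := Hspace_pre_hilbert dot_norm.

Lemma hnorm_ge0 x : 0 <= hn x. Proof. exact: norm_ge0. Qed.

Lemma dotxx (x : H) : dot x x = rl (hn x ^+ 2).
Proof. exact: (ip_norm pH (x := x) Logic.I). Qed.

Lemma bounded_sums_comb (J : choiceType) (a b c : J -> R) (s t : R) :
  0 <= s -> 0 <= t ->
  bounded_sums a -> bounded_sums b -> (forall i, c i <= s * a i + t * b i) ->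
  bounded_sums c.
Proof.
move=> s0 t0 [M hM] [N hN] h; exists (s * M + t * N) => F.
apply: le_trans (ler_sum _ (fun i _ => h i)) _.
by rewrite big_split/= -!mulr_sumr lerD// ler_wpM2l.
Qed.

Section one_family.
Variable U : I -> set H.
Hypothesis closed_U : forall i, closed_subspace (U i).
Local Notation KU := (Kspace dot U).
Implicit Types x y : I -> H.

Let pU i := closed_subspace_pre_hilbert dot_norm (closed_U i).

Lemma Kspace_domP x : dom KU x <->
  (forall i, U i (x i)) /\ bounded_sums (fun i => hn (x i) ^+ 2).
Proof.
have := esum_lty_bounded (fun i => exprn_ge0 2 (hnorm_ge0 (x i))).
by move=> [h1 h2]; split=> -[Ux ?]; split=> //; [exact: h1|exact: h2].
Qed.

(** The series converges absolutely, |<x i, y i>| being at most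
    |x i|^2 + |y i|^2. *)
Lemma has_sum_ip x y : dom KU x -> dom KU y ->
  has_sum (fun i => dot (x i) (y i) : K^o) (ip (i := KU) x y : K^o).
Proof.
move=> /Kspace_domP[_ bx] /Kspace_domP[_ bY].
have [e0|all0] := pselect (exists e : H, e != 0).
  apply: (has_sum_scalar dot_norm _ _ e0); last first.
    by move=> i; exact: (Cauchy_Schwarz pH).
  apply: (bounded_sums_comb (ler01 : 0 <= (1 : R)) ler01 bx bY) => i.
  rewrite !mul1r -/(hn (x i)) -/(hn (y i)).
  have := sqr_ge0 (hn (x i) - hn (y i)); rewrite sqrrB.
  have := sqr_ge0 (hn (x i)); have := sqr_ge0 (hn (y i)); lra.
have z0 (z : H) : z = 0.
  by apply/eqP; apply: contra_notT all0 => z0; exists z.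
have h : (fun i => dot (x i) (y i) : K^o) = fun=> 0.
  by apply/funext => i; rewrite (z0 (x i)) linear0l.
by rewrite /= h (has_sumE (@has_sum0 R k I K^o)); exact: has_sum0.
Qed.

Lemma Kspace_pre_hilbert : pre_hilbert KU.
Proof.
have d0 : dom KU 0.
  apply/Kspace_domP; split=> [i|]; first by case: (closed_U i).
  exists 0 => F; rewrite big1// => i _.
  by rewrite /hnorm (norm0 pH) expr0n.
have dP (a : K) x y : dom KU x -> dom KU y -> dom KU (a *: x + y).
  move=> /Kspace_domP[Ux bx] /Kspace_domP[Uy bY]; apply/Kspace_domP; split=> [i|].
    exact: (domP (pU i)).
  have s0 : 0 <= 2 * re `|a| ^+ 2 by rewrite mulr_ge0// exprn_ge0// re_norm_ge0.
  apply: (bounded_sums_comb s0 (ler0n _ 2) bx bY) => i.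
  have := sqr_ge0 (re `|a| * hn (x i) - hn (y i)).
  have : hn (a *: x i + y i) ^+ 2 <= (re `|a| * hn (x i) + hn (y i)) ^+ 2.
    rewrite ler_pXn2r// ?nnegrE ?addr_ge0 ?mulr_ge0 ?hnorm_ge0 ?re_norm_ge0//.
    apply: le_trans (norm_triangle pH (x := a *: x i) _ _) _ => //.
    by rewrite (normZ pH).
  rewrite sqrrB sqrrD exprMn /=; lra.
have ip_sup x : dom KU x -> ip (i := KU) x x = rl (sup_sum (fun i => hn (x i) ^+ 2)).
  move=> dx; apply: (has_sum_uniq (V := K^o) (has_sum_ip dx dx)).
  under [X in has_sum X]eq_fun do rewrite dotxx.
  apply: has_sum_of_real; first by move=> i; rewrite exprn_ge0// hnorm_ge0.
  by case/Kspace_domP: dx.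
split=> //.
- move=> a x y z dx dy dz.
  have hs := has_sumP (a := a) (has_sum_ip dx dz) (has_sum_ip dy dz).
  apply: (has_sum_uniq (has_sum_ip (dP a _ _ dx dy) dz)).
  by move: hs; congr has_sum; apply/funext => i; rewrite /= linearPl.
- move=> x y dx dy; apply: (has_sum_uniq (has_sum_ip dx dy)).
  have := has_sum_ip dy dx; rewrite /has_sum.
  apply: (@cvg_dist_bound R k K^o K^o _ totally _ _ _ _ _ 1) => F.
  rewrite !partial_sumE mul1r.
  rewrite (_ : \sum_(i <- F) dot (x i) (y i) =
      conj_scalar R k (\sum_(i <- F) dot (y i) (x i))); last first.
    rewrite rmorph_sum; apply: eq_bigr => i _.
    exact: dotC.
  rewrite -rmorphB /=.
  rewrite -(@ler_of_real _ k) !of_real_norm.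
  rewrite -(@ler_pXn2r _ 2)// ?nnegrE// -!mulcj conj_scalarK.
  by rewrite mulrC.
- move=> x dx; rewrite ip_sup// -(rmorph0 rl) ler_of_real.
  apply: le_trans (le_sup_sum _ fset0); first by rewrite big_seq_fset0.
  by case/Kspace_domP: dx.
- move=> x dx; rewrite ip_sup// -(rmorph0 rl) => /(congr1 (@re R k)).
  rewrite !of_realK => s0; apply/funext => i.
  have /Kspace_domP[_ bx] := dx.
  have := le_sup_sum bx [fset i]%fset; rewrite s0 big_seq_fset1 => h.
  apply: (norm_eq0 pH) => //; apply/eqP.
  by rewrite -sqrf_eq0 eq_le h sqr_ge0.
Qed.
Let pK := Kspace_pre_hilbert.

Lemma Kspace_norm_sq x : dom KU x ->
  norm KU x ^+ 2 = sup_sum (fun i => hn (x i) ^+ 2).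
Proof.
move=> dx; have /Kspace_domP[_ bx] := dx.
apply: (can_inj (@of_realK R k)); rewrite -(ip_norm pK dx).
apply: (has_sum_uniq (V := K^o) (has_sum_ip dx dx)).
under [X in has_sum X]eq_fun do rewrite dotxx.
by apply: has_sum_of_real => // i; rewrite exprn_ge0// hnorm_ge0.
Qed.

Lemma sum_le_Kspace_norm x (F : {fset I}) : dom KU x ->
  \sum_(i <- F) hn (x i) ^+ 2 <= norm KU x ^+ 2.
Proof.
move=> dx; rewrite Kspace_norm_sq//; apply: le_sup_sum.
by case/Kspace_domP: dx.
Qed.

Lemma Kspace_norm_le x (M : R) : dom KU x -> 0 <= M ->
  (forall F : {fset I}, \sum_(i <- F) hn (x i) ^+ 2 <= M ^+ 2) -> norm KU x <= M.
Proof.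
move=> dx M0 h; rewrite -(ler_pXn2r (n := 2))// ?nnegrE ?norm_ge0//.
by rewrite Kspace_norm_sq//; exact: sup_sum_le.
Qed.

Definition single (i : I) (a : H) : I -> H := fun j => if j == i then a else 0.

Definition restrict (F : {fset I}) (x : I -> H) : I -> H :=
  fun i => if i \in F then x i else 0.

Lemma restrict_sum F x : restrict F x = \sum_(i <- F) single i (x i).
Proof.
apply/funext => j; rewrite /restrict fct_sumE /single.
case: ifPn => [jF|njF].
  rewrite (big_fsetD1 j)//= eqxx big1_fset ?addr0// => i.
  by rewrite !inE eq_sym => /andP[/negbTE->].
by rewrite big1_fset// => i iF _; case: eqP => // ji; rewrite ji iF in njF.
Qed.

Lemma dom_finite x (F : {fset I}) : (forall i, U i (x i)) ->
  (forall i, i \notin F -> x i = 0) -> dom KU x.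
Proof.
move=> Ux x0; apply/Kspace_domP; split=> //.
have a0 i : 0 <= hn (x i) ^+ 2 by rewrite exprn_ge0// hnorm_ge0.
exists (\sum_(i <- F) hn (x i) ^+ 2) => B.
apply: le_trans (le_fset_sum a0 (fsubsetUl B F)) _.
rewrite -(big_fset_incl _ (fsubsetUr B F))// => i _ /x0 ->.
by rewrite /hnorm (norm0 pH) expr0n.
Qed.

Lemma dom_restrict F x : (forall i, U i (x i)) -> dom KU (restrict F x).
Proof.
move=> Ux; apply: (@dom_finite _ F) => i; rewrite /restrict.
  by case: ifP => // _; case: (closed_U i).
by move=> /negbTE ->.
Qed.

Lemma dom_single i a : U i a -> dom KU (single i a).
Proof.
move=> Ua; apply: (@dom_finite _ [fset i]%fset) => j; rewrite /single.
  by case: eqP => [->//|_]; case: (closed_U j).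
by rewrite inE => /negbTE ->.
Qed.

Lemma ip_single i a y : U i a -> dom KU y ->
  ip (i := KU) (single i a) y = dot a (y i).
Proof.
move=> Ua dy; apply: (has_sum_uniq (V := K^o) (has_sum_ip (dom_single Ua) dy)).
rewrite [X in has_sum _ X](_ : _ =
    \sum_(j <- [fset i]%fset) dot (single i a j) (y j)); last first.
  by rewrite big_seq_fset1 /single eqxx.
apply: (has_sum_fset (V := K^o)) => j; rewrite inE /single => /negbTE ->.
by rewrite linear0l.
Qed.

Lemma ip_restrict F x y : (forall i, U i (x i)) -> dom KU y ->
  ip (i := KU) (restrict F x) y = \sum_(i <- F) dot (x i) (y i).
Proof.
move=> Ux dy; apply: (has_sum_uniq (V := K^o) (has_sum_ip (dom_restrict F Ux) dy)).
rewrite (eq_big_seq (fun i => dot (restrict F x i) (y i))); last first.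
  by move=> i iF; rewrite /restrict iF.
apply: (has_sum_fset (V := K^o)) => j; rewrite /restrict => /negbTE ->.
by rewrite linear0l.
Qed.

Lemma norm_restrict F x : (forall i, U i (x i)) ->
  norm KU (restrict F x) ^+ 2 = \sum_(i <- F) hn (x i) ^+ 2.
Proof.
move=> Ux; rewrite (norm_sq pK (dom_restrict F Ux)).
rewrite ip_restrict//; last exact: dom_restrict.
rewrite raddf_sum; apply: eq_big_seq => i iF /=.
by rewrite /restrict iF dotxx of_realK.
Qed.

Lemma norm_single i a : U i a -> norm KU (single i a) = hn a.
Proof.
move=> Ua; rewrite /norm ip_single//; last exact: dom_single.
by rewrite /single eqxx.
Qed.

Lemma Kspace_approx x (e : R) : dom KU x -> 0 < e ->
  exists F, norm KU (x - restrict F x) <= e.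
Proof.
move=> dx e0; have /Kspace_domP[Ux bx] := dx.
have [F hF] := tail_sum bx (exprn_gt0 2 e0); exists F.
apply: Kspace_norm_le; [|exact: ltW|move=> B].
  by apply: (domB pK) => //; exact: dom_restrict.
rewrite (big_fsetID _ (mem F)) /= big1_fset ?add0r; last first.
  move=> i; rewrite !inE /= => /andP[_ iF] _.
  rewrite -[(x - _) i]/(x i - restrict F x i) /restrict iF subrr.
  by rewrite /hnorm (norm0 pH) expr0n.
rewrite (eq_big_seq (fun i => hn (x i) ^+ 2)); last first.
  move=> i; rewrite !inE /= => /andP[_ iF].
  by rewrite -[(x - _) i]/(x i - restrict F x i) /restrict (negbTE iF) subr0.
apply: hF; apply/fdisjointP => i iF.
by rewrite !inE /= iF andbF.
Qed.

(** Each component of a bounded functional is represented in U i by Riesz.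
    Testing the functional on the restriction of the resulting family z to a
    finite set F gives sum_F |z i|^2 <= C |z restricted to F|, hence the sums of
    |z i|^2 are at most C^2; density of the finitely supported families then
    identifies the functional with the product by z. *)
Lemma Kspace_representable : representable KU.
Proof.
move=> phi bphi; have [lphi [C0 hC0]] := bphi.
pose C := `|C0|; have C_ge0 : 0 <= C by exact: normr_ge0.
have hC x : dom KU x -> re (phi x) <= C * norm KU x.
  by move=> dx; apply: le_trans (hC0 x dx) _; rewrite ler_wpM2r ?norm_ge0// ler_norm.
have phi_sum (F : seq I) (f : I -> I -> H) : (forall i, dom KU (f i)) ->
    phi (\sum_(i <- F) f i) = \sum_(i <- F) phi (f i).
  move=> df; elim: F => [|i F IH]; first by rewrite !big_nil (functional0 pK bphi).
  rewrite !big_cons -IH -[f i in LHS]scale1r lphi ?mul1r//.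
  exact: (dom_sum pK).
have /choice[z hz] (i : I) : exists z, U i z /\
    forall a, U i a -> phi (single i a) = dot a z.
  have bi : bounded_functional (X := IpSpace (U i) dot) (fun a => phi (single i a)).
    split=> [b x y /= Ux Uy|].
      rewrite -lphi; try exact: dom_single.
      congr phi; apply/funext => j.
      rewrite -[RHS]/(b *: single i x j + single i y j) /single.
      by case: ifP => // _; rewrite scaler0 addr0.
    exists C => x /= Ux; apply: le_trans (hC _ (dom_single Ux)) _.
    by rewrite norm_single.
  by have [z Uz hz] := Riesz dot_norm (closed_U i) bi; exists z.
have Uz i : U i (z i) by case: (hz i).
have phi_single i a : U i a -> phi (single i a) = dot a (z i).
  by case: (hz i) => _; apply.
have phi_sumF F x : (forall i, U i (x i)) ->
    phi (restrict F x) = \sum_(i <- F) dot (x i) (z i).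
  move=> Ux; rewrite restrict_sum phi_sum; last by move=> i; exact: dom_single.
  by apply: eq_bigr => i _; rewrite phi_single.
have dz : dom KU z.
  apply/Kspace_domP; split=> //; exists (C ^+ 2) => F.
  have dzF := dom_restrict F Uz.
  set n := norm KU (restrict F z).
  have n0 : 0 <= n by exact: norm_ge0.
  have := hC _ dzF; rewrite phi_sumF// raddf_sum /=.
  under eq_bigr do rewrite dotxx of_realK.
  rewrite -norm_restrict// -/n => nC.
  rewrite ler_pXn2r// ?nnegrE//.
  have [->//|n_neq0] := eqVneq n 0.
  have n_gt0 : 0 < n by rewrite lt_def n_neq0.
  by rewrite -(ler_pM2r n_gt0) -expr2.
exists z => // x dx; apply/eqP; rewrite -subr_eq0; apply/eqP; move: x dx.
have bpsi : bounded_functional (X := KU) (fun x => phi x - ip (i := KU) x z).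
  split=> [a x y dx dy|].
    by rewrite lphi// (ipP pK)// opprD addrACA mulrBr.
  exists (C + norm KU z) => x dx.
  rewrite raddfB /= mulrDl; apply: lerD; first exact: hC.
  rewrite -raddfN /= -mulN1r -(ipZl pK)//.
  apply: le_trans (re_Cauchy_Schwarz pK (domZ pK _ dx) dz) _.
  by rewrite (normZ pK)// normrN1 -(rmorph1 rl) of_realK mul1r mulrC.
apply: (functional_eq0 pK bpsi) => x dx.
have [lpsi [D hD]] := bpsi; have /Kspace_domP[Ux _] := dx.
have D0 : 0 < `|D| + 1 by rewrite ltr_wpDl.
apply/ler_addgt0Pr => e e0; rewrite add0r.
have [F hF] := Kspace_approx dx (divr_gt0 e0 D0).
have dF := dom_restrict F Ux.
have := lpsi 1 _ _ (domB pK dx dF) dF.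
rewrite scale1r subrK mul1r [X in _ = _ + X](_ : _ = 0) ?addr0; last first.
  by rewrite phi_sumF// ip_restrict// subrr.
move=> ->; apply: le_trans (hD _ (domB pK dx dF)) _.
apply: (@le_trans _ _ ((`|D| + 1) * norm KU (x - restrict F x))).
  by rewrite ler_wpM2r ?norm_ge0// (le_trans (ler_norm D))// lerDl.
by rewrite mulrC -ler_pdivlMr.
Qed.

End one_family.
End hilbert_direct_sum.

(** * Projections, synthesis and analysis operators *)

Section projections.
Variables (R : realType) (k : scalar_kind).
Local Notation K := (RorC R k).
Variables (H : completeNormedModType K) (dot : {dot H for @conj_scalar R k}).
Hypothesis dot_norm : forall x : H, dot x x = `|x| ^+ 2.
Local Notation hn := (hnorm dot).
Let pH := Hspace_pre_hilbert dot_norm.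

Lemma oblique_projP (U V : set H) f : direct_sum U V ->
  U (oblique_proj U V f) /\ V (f - oblique_proj U V f).
Proof.
move=> [/(_ f)[u Uu Vfu] _]; rewrite /oblique_proj.
by case: xgetP => [v _ //|/(_ u)]; case.
Qed.

Lemma oblique_proj_eq (U V : set H) f u :
  (forall x y, U x -> U y -> U (x - y)) ->
  (forall x y, V x -> V y -> V (x - y)) -> U `&` V = [set 0] ->
  U u -> V (f - u) -> oblique_proj U V f = u.
Proof.
move=> UB VB UV0 Uu Vfu; rewrite /oblique_proj.
case: xgetP => [v _ [Uv Vfv]|/(_ u)[]//]; apply/eqP; rewrite -subr_eq0; apply/eqP.
suff : (U `&` V) (v - u) by rewrite UV0.
split; first exact: UB.
have -> : v - u = f - u - (f - v) by rewrite opprB [RHS]addrC addrA subrK.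
exact: VB.
Qed.

Lemma orthB (U : set H) x y : orth dot U x -> orth dot U y -> orth dot U (x - y).
Proof. by move=> hx hy z Uz; rewrite linearBl /= hx// hy// subrr. Qed.

Lemma orth_cap (U : set H) : U 0 -> U `&` orth dot U = [set 0].
Proof.
move=> U0; apply/seteqP; split=> [x [Ux /(_ x Ux)]|_ -> /=].
  exact: (ip_eq0 pH).
by split=> // y _; rewrite linear0l.
Qed.

Lemma dot_orth (U : set H) x y : U x -> orth dot U y -> dot x y = 0.
Proof.
by move=> Ux /(_ x Ux); rewrite (dotC dot x) => ->; rewrite rmorph0.
Qed.

Section orthogonal.
Variable U : set H.
Hypothesis cU : closed_subspace U.
Let pU := closed_subspace_pre_hilbert dot_norm cU.

Lemma orth_direct_sum : direct_sum U (orth dot U).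
Proof.
split; last by apply: orth_cap; exact: (dom0 pU).
move=> f; have bf : bounded_functional (X := IpSpace U dot) (fun x => dot x f).
  split=> [a x y _ _|]; first by rewrite linearPl.
  by exists (hn f) => x _; rewrite mulrC; exact: (re_Cauchy_Schwarz pH).
have [u Uu hu] := Riesz dot_norm cU bf; exists u => // y Uy.
by rewrite (dotC dot _ y) linearBr /= hu// subrr rmorph0.
Qed.

Lemma orth_projP f : U (orth_proj dot U f) /\ orth dot U (f - orth_proj dot U f).
Proof. exact: oblique_projP orth_direct_sum. Qed.

Lemma orth_proj_eq f u : U u -> orth dot U (f - u) -> orth_proj dot U f = u.
Proof.
apply: oblique_proj_eq; [by move=> x y; exact: (domB pU)|by move=> x y; exact: orthB|].
by apply: orth_cap; exact: (dom0 pU).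
Qed.

Lemma dot_orth_proj a f : U a -> dot a (orth_proj dot U f) = dot a f.
Proof.
move=> Ua; have [_ /(dot_orth Ua)/eqP] := orth_projP f.
by rewrite linearBr subr_eq0 => /eqP ->.
Qed.

End orthogonal.

End projections.

Section fusion_bessel.
Variables (R : realType) (k : scalar_kind).
Local Notation K := (RorC R k).
Local Notation rl := (@of_real R k).
Variables (H : completeNormedModType K) (dot : {dot H for @conj_scalar R k}).
Hypothesis dot_norm : forall x : H, dot x x = `|x| ^+ 2.
Variable I : countType.
Local Notation hn := (hnorm dot).
Local Notation HS := (Hspace dot).
Let pH := Hspace_pre_hilbert dot_norm.

Lemma Hspace_representable : representable HS.
Proof. by apply: (Riesz dot_norm); split=> //; exact: closedT. Qed.

Lemma has_sum_op (J : choiceType) (A : H -> H) (x : J -> H) (l : H) :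
  bounded_operator HS HS A -> has_sum x l -> has_sum (fun i => A (x i)) (A l).
Proof.
move=> bA; have [C C0 hC] := op_bound bA; rewrite /has_sum.
apply: (@cvg_dist_bound R k H H _ totally _ _ _ _ _ C) => F.
rewrite -!(hnormE dot_norm) !partial_sumE.
rewrite (_ : A l - _ = A (l - \sum_(i <- F) x i)); first exact: hC.
rewrite (opB pH bA)//; congr (_ - _); apply/esym.
elim/big_rec2: _ => [|i y z _ <-]; first exact: (op0 pH bA).
exact: (opD bA).
Qed.

Section one_family.
Variables (S : set H) (U : I -> set H) (u : I -> R).
Hypothesis closed_S : closed_subspace S.
Hypothesis bessel_U : fusion_bessel dot S U u.
Local Notation KU := (Kspace dot U).
Local Notation T := (synthesis u).
Implicit Types (x y : I -> H).

Lemma fusion_bessel_closed i : closed_subspace (U i).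
Proof. by case: bessel_U => -[/(_ i)[]]. Qed.
Let cU := fusion_bessel_closed.

Lemma fusion_bessel_sub i a : U i a -> S a.
Proof. by case: bessel_U => -[/(_ i)[_ h] _] _; exact: h. Qed.

Lemma fusion_bessel_gt0 i : 0 < u i.
Proof. by case: bessel_U => -[_ [h _]] _; exact: h. Qed.

Let pK := Kspace_pre_hilbert dot_norm cU.
Let pS := closed_subspace_pre_hilbert dot_norm closed_S.

(** Duality: with s = sum_F u_i x_i, which lies in S,
    |s|^2 = sum_F <x_i, u_i pi_i s> is at most
    (beta sum_F |x_i|^2 + beta^-1 sum_F u_i^2 |pi_i s|^2) / 2, and the Bessel
    inequality bounds the last term by |s|^2 / 2. *)
Lemma finite_synthesis_bound : exists2 beta : R, 0 < beta &
  forall x (F : {fset I}), (forall i, U i (x i)) ->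
    hn (\sum_(i <- F) rl (u i) *: x i) ^+ 2 <=
    beta * \sum_(i <- F) hn (x i) ^+ 2.
Proof.
have [_ [beta b0 hb]] := bessel_U; exists beta => // x F Ux.
set s := \sum_(i <- F) _.
have Ss : S s.
  by apply: (dom_sum pS) => i; apply: (domZ pS); exact: fusion_bessel_sub (Ux i).
pose p i := rl (u i) *: orth_proj dot (U i) s.
have hp : \sum_(i <- F) hn (p i) ^+ 2 <= beta * hn s ^+ 2.
  have h0 i : 0 <= u i ^+ 2 * hn (orth_proj dot (U i) s) ^+ 2.
    by rewrite mulr_ge0// exprn_ge0// ?hnorm_ge0// ltW// fusion_bessel_gt0.
  have := (esum_le_fin _ h0).1 (hb _ Ss) F.
  congr (_ <= _); apply: eq_bigr => i _.
  rewrite /p /hnorm (norm_realZ pH _ (x := orth_proj dot (U i) s))//.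
  by rewrite exprMn real_normK ?num_real.
have ss : hn s ^+ 2 = \sum_(i <- F) re (dot (x i) (p i)).
  rewrite (norm_sq pH (x := s))// /= {1}/s linear_sumlz raddf_sum; apply: eq_bigr => i _.
  by rewrite linearZl_LR /p linearZr_LR /= conj_of_real (dot_orth_proj dot_norm (cU i)).
have le1 i : re (dot (x i) (p i)) <=
    2^-1 * (beta * hn (x i) ^+ 2) + 2^-1 * (beta^-1 * hn (p i) ^+ 2).
  apply: le_trans (re_Cauchy_Schwarz pH (x := x i) (y := p i) _ _) _ => //.
  rewrite -/(hn (x i)) -/(hn (p i)).
  have : 0 <= beta^-1 * (beta * hn (x i) - hn (p i)) ^+ 2.
    by rewrite mulr_ge0 ?sqr_ge0// invr_ge0 ltW.
  rewrite (_ : beta^-1 * _ = beta * hn (x i) ^+ 2 - 2 * (hn (x i) * hn (p i))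
      + beta^-1 * hn (p i) ^+ 2); last by field; rewrite gt_eqF.
  lra.
have : hn s ^+ 2 <= 2^-1 * (beta * \sum_(i <- F) hn (x i) ^+ 2) +
    2^-1 * (beta^-1 * \sum_(i <- F) hn (p i) ^+ 2).
  rewrite {1}ss !mulr_sumr -big_split /=; apply: ler_sum => i _; exact: le1.
have : beta^-1 * \sum_(i <- F) hn (p i) ^+ 2 <= hn s ^+ 2.
  by rewrite ler_pdivrMl.
lra.
Qed.

Lemma has_sum_synthesis x : dom KU x ->
  has_sum (fun i => rl (u i) *: x i) (T x).
Proof.
move=> /Kspace_domP[Ux bx]; apply: (has_sum_cauchy dot_norm) => e e0.
have [beta b0 hb] := finite_synthesis_bound.
have [F hF] := tail_sum bx (divr_gt0 (exprn_gt0 2 e0) b0).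
exists F => B /hF; rewrite ler_pdivlMr// mulrC => h.
rewrite -(ler_pXn2r (n := 2))// ?nnegrE ?hnorm_ge0 ?(ltW e0)//.
exact: le_trans (hb _ _ Ux) h.
Qed.

Lemma synthesis_bounded : bounded_operator KU HS T.
Proof.
split=> // [a x y dx dy|].
  have := has_sumP (a := a) (has_sum_synthesis dx) (has_sum_synthesis dy).
  apply: has_sum_uniq; have := has_sum_synthesis (domP pK a dx dy).
  congr has_sum; apply/funext => i.
  by rewrite -[(a *: x + y) i]/(a *: x i + y i) scalerDr !scalerA mulrC.
have [beta b0 hb] := finite_synthesis_bound.
exists (Num.sqrt beta) => x dx.
apply: (hnorm_le_of_cvg dot_norm (has_sum_synthesis dx)).
apply: nearW => F; rewrite partial_sumE.
rewrite -(ler_pXn2r (n := 2))// ?nnegrE ?mulr_ge0 ?sqrtr_ge0 ?norm_ge0 ?hnorm_ge0//.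
have /Kspace_domP[Ux _] := dx.
rewrite exprMn (sqr_sqrtr (ltW b0)); apply: le_trans (hb _ _ Ux) _.
by rewrite ler_wpM2l ?(ltW b0)// sum_le_Kspace_norm.
Qed.

Lemma synthesis_in x : dom KU x -> S (T x).
Proof.
move=> dx; apply: (closed_subspace_cvg closed_S _ (has_sum_synthesis dx)) => F.
have /Kspace_domP[Ux _] := dx.
rewrite partial_sumE; apply: (dom_sum pS) => i.
by apply: (domZ pS); exact: fusion_bessel_sub (Ux i).
Qed.

Lemma synthesis_single i (a : H) : T (single i a) = rl (u i) *: a.
Proof.
apply: has_sumE.
have := has_sum_fset (F := [fset i]%fset) (x := fun j => rl (u j) *: single i a j).
rewrite big_seq_fset1 /single eqxx; apply=> j; rewrite inE => /negbTE ->.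
exact: scaler0.
Qed.

Lemma analysisP : is_adjoint KU HS T (analysis dot U u).
Proof.
exact: adjointP pK pH _ synthesis_bounded (Kspace_representable dot_norm cU).
Qed.

Lemma analysis_dom f : dom KU (analysis dot U u f).
Proof. by apply: op_dom (analysisP).1 _ _. Qed.

Lemma dot_synthesis x f : dom KU x ->
  dot (T x) f = ip (i := KU) x (analysis dot U u f).
Proof. by move=> dx; exact: (analysisP.2 _ f dx). Qed.

(** Both sides have the same products with the vectors a of U i: on the left
    <a, (T* f) i> = <T (a placed at i), f> = u i <a, f>. *)
Lemma analysisE f i : analysis dot U u f i = rl (u i) *: orth_proj dot (U i) f.
Proof.
have ui0 : rl (u i) != 0.
  by rewrite fmorph_eq0 gt_eqF// fusion_bessel_gt0.
have [Ua _] := (Kspace_domP dot U _).1 (analysis_dom f).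
have pU := closed_subspace_pre_hilbert dot_norm (cU i).
rewrite (orth_proj_eq dot_norm (cU i) (u := (rl (u i))^-1 *: analysis dot U u f i)).
- by rewrite scalerA mulfV// scale1r.
- exact: (domZ pU _ (Ua i)).
move=> y Uy; rewrite (dotC dot _ y) linearBr linearZr_LR /=.
rewrite -(ip_single dot_norm cU Uy (analysis_dom f)).
rewrite -dot_synthesis; last exact: dom_single.
rewrite synthesis_single linearZl_LR /= fmorphV /= conj_of_real mulKf//.
by rewrite subrr rmorph0.
Qed.

Lemma frame_sumE f : frame_sum dot U u f = (norm KU (analysis dot U u f) ^+ 2)%:E.
Proof.
have [_ ba] := (Kspace_domP dot U _).1 (analysis_dom f).
rewrite (Kspace_norm_sq dot_norm cU (analysis_dom f)) -esum_sup_sum//.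
apply: eq_esum => i _; congr _%:E.
rewrite analysisE /hnorm (norm_realZ pH _ (x := orth_proj dot (U i) f))//.
by rewrite exprMn real_normK ?num_real.
Qed.

(** A bounded right inverse L of the synthesis operator on S forces the lower
    frame inequality: |f|^2 = <T (L f), f> = <L f, T* f> for f in S. *)
Lemma fusion_frame_right_inverse (L : H -> (I -> H)) :
  bounded_operator HS KU L -> (forall f, S f -> T (L f) = f) ->
  fusion_frame dot S U u.
Proof.
move=> bL hL; have [wU [beta b0 hb]] := bessel_U; split=> //.
have [C C0 hC] := op_bound bL.
exists (Num.min (C ^- 2) beta), beta; split=> [||f Sf].
- by rewrite lt_min b0 invr_gt0 exprn_gt0.
- by rewrite ge_min lexx orbT.
split; last exact: hb.
rewrite frame_sumE lee_fin.
apply: (@le_trans _ _ (C ^- 2 * hn f ^+ 2)).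
  by rewrite ler_wpM2r ?exprn_ge0 ?hnorm_ge0// ge_min lexx.
rewrite ler_pdivrMl ?exprn_gt0// -exprMn.
have Tf0 : 0 <= C * norm KU (analysis dot U u f).
  by rewrite mulr_ge0 ?norm_ge0// ltW.
rewrite ler_pXn2r ?nnegrE ?hnorm_ge0//.
have [->|f_neq0] := eqVneq (hn f) 0; first by [].
have f_gt0 : 0 < hn f by rewrite lt_def f_neq0 hnorm_ge0.
rewrite -(ler_pM2r f_gt0) -expr2 (norm_sq pH (x := f))//=.
have dL : dom KU (L f) by exact: op_dom bL _ _.
rewrite -{1}(hL f Sf) dot_synthesis//.
apply: le_trans (re_Cauchy_Schwarz pK dL (analysis_dom f)) _.
by rewrite mulrAC ler_wpM2r ?norm_ge0//; exact: hC.
Qed.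

Lemma component_opE (A : H -> H) (tu : I -> R) x i :
  component_op (A \o T) tu x i = (rl (tu i))^-1 *: A (rl (u i) *: x i).
Proof.
rewrite /component_op /=; congr (_ *: A _); rewrite -synthesis_single.
by congr synthesis; apply/funext => j; rewrite /keep /single; case: eqP => [->|].
Qed.

(** The weights cancel: T_(AU, tu) Q_(A T_U, tu) = A T_U. *)
Lemma synthesis_component_op (A : H -> H) (tu : I -> R) x : dom KU x ->
  bounded_operator HS HS A -> (forall i, 0 < tu i) ->
  synthesis tu (component_op (A \o T) tu x) = A (T x).
Proof.
move=> dx bA tu0; apply: has_sumE.
have := has_sum_op bA (has_sum_synthesis dx); congr has_sum; apply/funext => i.
by rewrite component_opE scalerA mulfV ?scale1r// fmorph_eq0 gt_eqF.
Qed.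

End one_family.

Lemma fusion_frame_bessel (S : set H) (U : I -> set H) (u : I -> R) :
  fusion_frame dot S U u -> fusion_bessel dot S U u.
Proof.
move=> [wU [alpha [beta [a0 ab h]]]]; split=> //.
by exists beta; [exact: lt_le_trans ab|move=> f /h[]].
Qed.

End fusion_bessel.

(** * Neumann series *)

Lemma subrACA (V : zmodType) (a b c d : V) : a - b - (c - d) = a - c - (b - d).
Proof. by rewrite !opprD !opprK addrACA. Qed.

Section neumann_series.
Variables (R : realType) (k : scalar_kind).
Local Notation K := (RorC R k).
Variables (H : completeNormedModType K) (dot : {dot H for @conj_scalar R k}).
Hypothesis dot_norm : forall x : H, dot x x = `|x| ^+ 2.
Local Notation hn := (hnorm dot).
Local Notation HS := (Hspace dot).
Let pH := Hspace_pre_hilbert dot_norm.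
Variables (D : H -> H) (eps : R).
Hypothesis bD : bounded_operator HS HS D.
Hypotheses (eps_ge0 : 0 <= eps) (eps_lt1 : eps < 1).
Hypothesis D_le : forall f, hn (D f) <= eps * hn f.

Let DB x y : D (x - y) = D x - D y.
Proof. exact: (opB pH bD (x := x) (y := y)). Qed.

Let hnB x y : hn (x - y) <= hn x + hn y.
Proof.
rewrite -scaleN1r; apply: le_trans (norm_triangle pH (x := x) (y := -1 *: y) _ _) _ => //.
rewrite (normZ pH _ (x := y))// normrN1 -(rmorph1 (@of_real R k)) of_realK mul1r.
exact: lexx.
Qed.

Let eps1 : 0 < 1 - eps. Proof. by rewrite subr_gt0. Qed.

Lemma contraction_norm_le h : hn h <= (1 - eps)^-1 * hn (h - D h).
Proof.
rewrite ler_pdivlMl// mulrBl mul1r lerBlDr.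
rewrite -{1}[h](subrK (D h)).
apply: le_trans (norm_triangle pH (x := h - D h) (y := D h) _ _) _ => //.
exact: lerD (lexx _) (D_le h).
Qed.

Lemma contraction_fixed h h' : h - D h = h' - D h' -> h = h'.
Proof.
move=> e; apply/eqP; rewrite -subr_eq0; apply/eqP; apply: (norm_eq0 pH) => //.
apply/eqP; rewrite eq_le norm_ge0 andbT.
apply: le_trans (contraction_norm_le _) _.
by rewrite DB subrACA e subrr /hnorm (norm0 pH) mulr0.
Qed.

Let partial (f : H) (N : nat) := \sum_(n < N) iter n D f.

Lemma iter_norm_le f n : hn (iter n D f) <= eps ^+ n * hn f.
Proof.
elim: n => [|n IH] /=; first by rewrite mul1r.
apply: le_trans (D_le _) _; rewrite exprS -mulrA.
by rewrite ler_wpM2l.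
Qed.

(** Together with [contraction_norm_le], this shows that the partial sums are
    Cauchy and estimates their distance to a solution of g - D g = f. *)
Lemma partial_telescope f N : partial f N - D (partial f N) = f - iter N D f.
Proof.
elim: N => [|N IH] /=; first by rewrite /partial big_ord0 (op0 pH bD) subr0 subrr.
rewrite /partial big_ord_recr /= -/(partial f N) (opD bD)//.
by rewrite opprD addrACA IH addrA subrK.
Qed.

Lemma eps_pow_small (M e : R) : 0 < e -> \forall N \near \oo, eps ^+ N * M <= e.
Proof.
move=> e0; have M1 : 0 < `|M| + 1 by rewrite ltr_wpDl.
have /cvgrPdist_le/(_ (e / (`|M| + 1))) : (fun n => eps ^+ n) @ \oo --> (0 : R).
  by apply: cvg_expr; rewrite ger0_norm.
move=> /(_ (divr_gt0 e0 M1)); apply: filterS => N.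
rewrite sub0r normrN ger0_norm ?exprn_ge0// ler_pdivlMr//; apply: le_trans.
by rewrite ler_wpM2l ?exprn_ge0// (le_trans (ler_norm M))// lerDl.
Qed.

Lemma neumann_solution f : exists g, g - D g = f.
Proof.
have cS : cvg (partial f @ \oo).
  apply: (cauchy_cvg_hnorm dot_norm) => e e0.
  have [N _ hN] := eps_pow_small ((1 - eps)^-1 * (2 * hn f)) e0.
  exists (partial f N); exists N => // n /= Nn.
  apply: le_trans (contraction_norm_le _) _; apply: le_trans (hN N (leqnn N)).
  rewrite [leRHS]mulrCA ler_pM2l ?invr_gt0// DB.
  rewrite subrACA !partial_telescope subrACA subrr sub0r opprB.
  apply: le_trans (hnB _ _) _.
  rewrite mulrCA mulr_natl mulr2n; apply: lerD; last exact: iter_norm_le.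
  apply: le_trans (iter_norm_le _ _) _; rewrite ler_wpM2r ?hnorm_ge0//.
  by rewrite ler_wiXn2l// ltW.
set g := lim (partial f @ \oo); exists g.
apply/eqP; rewrite -subr_eq0; apply/eqP; apply: (norm_eq0 pH) => //.
apply/eqP; rewrite eq_le norm_ge0 andbT; apply/ler_addgt0Pr => e e0; rewrite add0r.
have e4 : 0 < e / 4 by rewrite divr_gt0.
have [N1 _ h1] := (cvg_hnorm dot_norm _ _).1 cS _ e4.
have [N2 _ h2] := eps_pow_small (hn f) e4.
pose N := maxn N1 N2.
have {}h1 : hn (g - partial f N) <= e / 4 := h1 N (leq_maxl _ _).
have {}h2 := h2 N (leq_maxr _ _).
rewrite (_ : g - D g - f =
  (g - partial f N) - D (g - partial f N) - iter N D f); last first.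
  by rewrite DB subrACA partial_telescope -[RHS]addrA -opprD subrK.
apply: le_trans (hnB _ _) _.
have := hnB (g - partial f N) (D (g - partial f N)).
have := D_le (g - partial f N).
have := iter_norm_le f N.
have : eps * hn (g - partial f N) <= hn (g - partial f N).
  by rewrite ler_piMl ?hnorm_ge0// ltW.
lra.
Qed.

Lemma neumann_partial_dist f g N : g - D g = f ->
  hn (partial f N - g) <= eps ^+ N * ((1 - eps)^-1 * hn f).
Proof.
move=> eg; apply: le_trans (contraction_norm_le _) _.
rewrite [leRHS]mulrCA ler_pM2l ?invr_gt0//.
rewrite (_ : _ - _ = - iter N D f); last first.
  by rewrite DB subrACA eg partial_telescope addrAC subrr sub0r.
rewrite -scaleN1r /hnorm (normZ pH)// normrN1 -(rmorph1 (@of_real R k)) of_realK mul1r.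
exact: iter_norm_le.
Qed.

(** The inverse B of 1 - D exists by completeness, and |S_N f - B f| is at most
    eps^N |f| / (1 - eps) for the partial sums S_N f, so the series converges to B
    in operator norm.  Any other limit in operator norm has the same values. *)
Lemma neumann_series : let A := opseries HS (fun n => iter n D) in
  [/\ opseries_cvg HS (fun n => iter n D) A,
      forall f, A f - D (A f) = f
    & forall f, A (f - D f) = f].
Proof.
have /choice[B hB] := neumann_solution.
have B_le f : hn (B f) <= (1 - eps)^-1 * hn f.
  by rewrite -{2}(hB f); exact: contraction_norm_le.
have cB : opseries_cvg HS (fun n => iter n D) B.
  split.
    split=> // [a x y _ _|]; last by exists ((1 - eps)^-1) => x _; exact: B_le.
    apply: contraction_fixed; rewrite hB (opP bD)//.
    by rewrite opprD addrACA -scalerBr !hB.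
  have opn N : (0 <= opnorm HS HS (fun x => (\sum_(n < N) iter n D x - B x)%R)
      <= (eps ^+ N * (1 - eps)^-1)%:E)%E.
    apply/andP; split.
      apply: (@le_trans _ _ (norm HS (\sum_(n < N) iter n D 0 - B 0))%:E).
        by rewrite lee_fin norm_ge0.
      apply: ereal_sup_ubound; exists 0 => //.
      by split=> //; rewrite (norm0 pH).
    apply: opnorm_le => [|x _].
      by rewrite mulr_ge0 ?exprn_ge0// invr_ge0 ltW.
    by rewrite -mulrA; exact: neumann_partial_dist.
  apply: (@squeeze_cvge _ _ _ _ (fun=> 0%E) _ (fun N => (eps ^+ N * (1 - eps)^-1)%:E)).
  - exact: nearW.
  - exact: cvg_cst.
  apply: cvg_EFin; first exact: nearW.
  rewrite -(mul0r (1 - eps)^-1); apply: cvgMl.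
  by apply: cvg_expr; rewrite ger0_norm.
have cA : opseries_cvg HS (fun n => iter n D) (opseries HS (fun n => iter n D)).
  by rewrite /opseries; case: xgetP => [A _ //|/(_ B)].
move=> A; have AB f : A f = B f.
  have [bA lA] : opseries_cvg HS (fun n => iter n D) A := cA.
  have iterZ (a : K) x n : iter n D (a *: x) = a *: iter n D x.
    by elim: n => //= n ->; exact: (opZ pH bD).
  apply/eqP; rewrite -subr_eq0; apply/eqP; apply: (norm_eq0 pH) => //.
  apply/eqP; rewrite eq_le norm_ge0 andbT; apply/ler_addgt0Pr => e e0; rewrite add0r.
  have f1 : 0 < hn f + 1 by rewrite ltr_wpDl ?hnorm_ge0.
  have e2 : 0 < e / 2 by rewrite divr_gt0.
  have [N1 _ h1] := eps_pow_small ((1 - eps)^-1 * hn f) e2.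
  have e2f : (0%E < (e / 2 / (hn f + 1))%:E)%E by rewrite lte_fin divr_gt0.
  have [N2 _ h2] := lA _ (open_nbhs_nbhs (conj (open_ereal_lt_ereal (x := _)) e2f)).
  pose N := maxn N1 N2.
  have {}h1 := h1 N (leq_maxl _ _).
  have {}h2 := h2 N (leq_maxr _ _).
  have h3 : hn (partial f N - A f) <= e / 2 / (hn f + 1) * hn f.
    apply: (le_opnorm pH pH (L := fun x => partial x N - A x)) => //; last exact: ltW.
    move=> a x _; rewrite /partial (opZ pH bA)// scalerBr scaler_sumr.
    by congr (_ - _); apply: eq_bigr => i _; rewrite iterZ.
  have h4 := neumann_partial_dist N (hB f).
  rewrite (_ : A f - B f = partial f N - B f - (partial f N - A f)); last first.
    by rewrite subrACA subrr sub0r opprB.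
  apply: le_trans (hnB _ _) _.
  have : e / 2 / (hn f + 1) * hn f <= e / 2.
    by rewrite mulrAC ler_pdivrMr// ler_wpM2l ?(ltW e2)// lerDl.
  lra.
split=> [//|f|f]; first by rewrite AB hB.
by apply: contraction_fixed; rewrite AB hB.
Qed.

End neumann_series.

(** * Oblique projections and duals *)

Section oblique_projections.
Variables (R : realType) (k : scalar_kind).
Local Notation K := (RorC R k).
Variables (H : completeNormedModType K) (dot : {dot H for @conj_scalar R k}).
Hypothesis dot_norm : forall x : H, dot x x = `|x| ^+ 2.
Variables SV SW : set H.
Hypotheses (SV_closed : closed_subspace SV) (SW_closed : closed_subspace SW).
Hypothesis H_sum : direct_sum SV (orth dot SW).
Local Notation p := (oblique_proj SV (orth dot SW)).
Let pV := closed_subspace_pre_hilbert dot_norm SV_closed.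
Let pW := closed_subspace_pre_hilbert dot_norm SW_closed.

Lemma orth0 (U : set H) : orth dot U 0.
Proof. by move=> y _; exact: linear0l. Qed.

Lemma oblique_proj_in f : SV (p f).
Proof. by case: (oblique_projP f H_sum). Qed.

Lemma oblique_proj_orth f : orth dot SW (f - p f).
Proof. by case: (oblique_projP f H_sum). Qed.

Lemma oblique_proj_uniq f u : SV u -> orth dot SW (f - u) -> p f = u.
Proof.
apply: oblique_proj_eq; [|by move=> x y; exact: orthB|by case: H_sum].
by move=> x y; exact: (domB pV).
Qed.

Lemma oblique_proj_id f : SV f -> p f = f.
Proof. by move=> Vf; apply: oblique_proj_uniq => //; rewrite subrr; exact: orth0. Qed.

Lemma oblique_proj_ker f : orth dot SW f -> p f = 0.
Proof. by move=> Wf; apply: oblique_proj_uniq; [exact: (dom0 pV)|rewrite subr0]. Qed.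

Lemma oblique_projL (a : K) x y : p (a *: x + y) = a *: p x + p y.
Proof.
apply: oblique_proj_uniq; first by apply: (domP pV); exact: oblique_proj_in.
rewrite opprD addrACA -scalerBr => z Wz.
rewrite linearDl linearZl_LR /= (oblique_proj_orth x Wz) (oblique_proj_orth y Wz).
by rewrite mulr0 addr0.
Qed.

Lemma oblique_projZ (a : K) x : p (a *: x) = a *: p x.
Proof.
have p0 : p 0 = 0 by apply: oblique_proj_ker; exact: orth0.
by rewrite -[a *: x]addr0 oblique_projL p0 !addr0.
Qed.

(** The sum of W and the orthogonal of V is direct: with p the projection onto V
    along the orthogonal of W, a common vector u of these two subspaces satisfies
    <u, u> = <u - p u, u> + <p u, u> = 0. *)
Lemma dual_oblique_proj_uniq f u : SW u -> orth dot SV (f - u) ->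
  oblique_proj SW (orth dot SV) f = u.
Proof.
apply: oblique_proj_eq; [by move=> x y; exact: (domB pW)|by move=> x y; exact: orthB|].
apply/seteqP; split=> [x [Wx Vx]|_ -> /=]; last first.
  by split; [exact: (dom0 pW)|exact: orth0].
apply: (ip_eq0 pW Wx) => /=; rewrite -{1}[x](subrK (p x)) linearDl /=.
by rewrite (oblique_proj_orth x Wx) (dot_orth (oblique_proj_in x) Vx) addr0.
Qed.

End oblique_projections.

Theorem theorem5p3 (R : realType) (k : scalar_kind)
    (H : completeNormedModType (RorC R k)) (dot : {dot H for @conj_scalar R k})
    (dot_norm : forall x : H, dot x x = `|x| ^+ 2)
    (H_separable : separable H)
    (I : countType) (SV SW : set H)
    (SV_closed : closed_subspace SV) (SW_closed : closed_subspace SW)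
    (H_sum : direct_sum SV (orth dot SW))
    (V W : I -> set H) (v w : I -> R)
    (frame_W : fusion_frame dot SW W w) (frame_V : fusion_frame dot SV V v)
    (Q : (I -> H) -> (I -> H))
    (Q_bounded : bounded_operator (Kspace dot W) (Kspace dot V) Q)
    (eps : R) (eps_ge0 : 0 <= eps) (eps_lt1 : eps < 1)
    (dual_VW : approx_oblique_dual dot eps SW W w SV V v Q) :
  let D : H -> H := fun f =>
    oblique_proj SV (orth dot SW) f - synthesis v (Q (analysis dot W w f)) in
  let A : H -> H := opseries (Hspace dot) (fun n => iter n D) in
  let Astar : H -> H := adjoint (Hspace dot) (Hspace dot) A in
  let Qstar := adjoint (Kspace dot W) (Kspace dot V) Q in
  [/\ bounded_operator (Hspace dot) (Hspace dot) A,
      opseries_cvg (Hspace dot) (fun n => iter n D) A,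
      forall f, A (f - D f) = f
    & forall f, A f - D (A f) = f] /\
  forall tv tw : I -> R, weights tv -> weights tw ->
  let AV := image_family A V in
  let AstarW := image_family Astar W in
  let QV := component_op (A \o synthesis v) tv in
  let QW := component_op (Astar \o synthesis w) tw in
  let QWstar := adjoint (Kspace dot W) (Kspace dot AstarW) QW in
  fusion_bessel dot SV AV tv -> fusion_bessel dot SW AstarW tw ->
  bounded_operator (Kspace dot V) (Kspace dot AV) QV ->
  bounded_operator (Kspace dot W) (Kspace dot AstarW) QW ->
  [/\ oblique_dual dot SW W w SV AV tv (QV \o Q),
      oblique_dual dot SV V v SW AstarW tw (QW \o Qstar)
    & forall Qi : (I -> H) -> (I -> H),
      bounded_operator (Kspace dot V) (Kspace dot W) Qi ->
      (set_surj (dom (Kspace dot W)) (dom (Kspace dot V)) Q /\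
         {in dom (Kspace dot V), cancel Qi Q}) \/
      (set_inj (dom (Kspace dot W)) Q /\
         {in dom (Kspace dot W), cancel Q Qi}) ->
      approx_oblique_dual dot (eps / (1 - eps)) SW AstarW tw SV AV tv
        (QV \o Q \o QWstar)].
Proof.
move=> D A Astar Qstar.
have pH := Hspace_pre_hilbert dot_norm; have rH := Hspace_representable dot_norm.
have bessel_W := fusion_frame_bessel frame_W.
have bessel_V := fusion_frame_bessel frame_V.
have cV := fusion_bessel_closed bessel_V; have cW := fusion_bessel_closed bessel_W.
have pKV := Kspace_pre_hilbert dot_norm cV; have pKW := Kspace_pre_hilbert dot_norm cW.
have rKW := Kspace_representable dot_norm cW.
have bTV := synthesis_bounded dot_norm SV_closed bessel_V.
have [bTW' _] := analysisP dot_norm SW_closed bessel_W.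
have [bTV' _] := analysisP dot_norm SV_closed bessel_V.
pose S f := synthesis v (Q (analysis dot W w f)).
have bS : bounded_operator (Hspace dot) (Hspace dot) S.
  exact: bounded_operator_comp (bounded_operator_comp pH pKW bTW' Q_bounded) bTV.
have DL (a : RorC R k) x y : D (a *: x + y) = a *: D x + D y.
  rewrite /D (oblique_projL dot_norm SV_closed H_sum) -!/(S _) (opP bS)//.
  by rewrite scalerBr opprD addrACA.
have D_le f : hnorm dot (D f) <= eps * hnorm dot f.
  have [_ _ _ _ h] := dual_VW.
  rewrite /hnorm (norm_sub pH)//; apply: (le_opnorm pH pH _ _ h) => // a x _.
  rewrite -!/(S _) (opZ pH bS)// scalerBr.
  by rewrite (oblique_projZ dot_norm SV_closed H_sum).
have bD : bounded_operator (Hspace dot) (Hspace dot) D.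
  by split=> //; exists eps => x _; exact: D_le.
have [cA AD AD'] := neumann_series dot_norm bD eps_ge0 eps_lt1 D_le.
rewrite -/A in cA AD AD'.
have bA := cA.1.
split; first by split.
have [bAs As_adj] := adjointP pH pH bA rH.
rewrite -/Astar in bAs As_adj.
pose p f := oblique_proj SV (orth dot SW) f.
have p_in f : SV (p f) := oblique_proj_in H_sum f.
have p_id f : SV f -> p f = f := oblique_proj_id dot_norm SV_closed H_sum (f := f).
have pS := closed_subspace_pre_hilbert dot_norm SV_closed.
have S_in f : SV (S f).
  apply: (synthesis_in dot_norm SV_closed bessel_V).
  by apply: (op_dom Q_bounded); exact: (op_dom bTW').
have D_in f : SV (D f) by exact: (domB pS (p_in f) (S_in f)).
(* Both p g and T_W* g vanish: g is orthogonal to SW, which contains each W i. *)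
have D_ker g : orth dot SW g -> D g = 0.
  move=> Wg; rewrite /D (oblique_proj_ker dot_norm SV_closed H_sum Wg).
  suff -> : analysis dot W w g = 0.
    by rewrite (op0 pKW Q_bounded) (op0 pKV bTV) subr0.
  apply/funext => i; rewrite (analysisE dot_norm SW_closed bessel_W).
  rewrite (orth_proj_eq dot_norm (cW i) (u := 0)) ?scaler0//; first by case: (cW i).
  by rewrite subr0 => y /(fusion_bessel_sub bessel_W); exact: Wg.
(* S f = (f - D f) - (f - p f), and A fixes the second term, which D kills. *)
have AS f : A (S f) = p f.
  have e : S f = (f - D f) - (f - p f).
    by rewrite subrACA subrr sub0r opprB /D opprB addrC subrK.
  have kerf : orth dot SW (f - p f) := oblique_proj_orth H_sum f.
  have Aker : A (f - p f) = f - p f.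
    by have := AD' (f - p f); rewrite D_ker// subr0.
  by rewrite e (opB pH bA)// AD' Aker opprB addrC subrK.
(* A f = f + D (A f), and D takes its values in SV, which p fixes. *)
have pA f : p (A f) = p f + D (A f).
  have e : A f = 1 *: f + D (A f) by rewrite scale1r -[X in _ = X + _](AD f) subrK.
  rewrite {1}e /p (oblique_projL dot_norm SV_closed H_sum) scale1r.
  by rewrite -!/(p _) (p_id _ (D_in _)).
have SA f : S (A f) = p f.
  have -> : S (A f) = p (A f) - D (A f) by rewrite /D opprB addrC subrK.
  by rewrite pA addrK.
move=> tv tw wtv wtw AV AstarW QV QW QWstar bessel_AV bessel_AW bQV bQW.
have tv0 : forall i, 0 < tv i by case: wtv.
have tw0 : forall i, 0 < tw i by case: wtw.
have cAV := fusion_bessel_closed bessel_AV.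
have cAW := fusion_bessel_closed bessel_AW.
have pKAV := Kspace_pre_hilbert dot_norm cAV.
have pKAW := Kspace_pre_hilbert dot_norm cAW.
have TQV x : dom (Kspace dot V) x -> synthesis tv (QV x) = A (synthesis v x).
  by move=> dx; exact: (synthesis_component_op dot_norm SV_closed bessel_V).
have TQW x : dom (Kspace dot W) x -> synthesis tw (QW x) = Astar (synthesis w x).
  by move=> dx; exact: (synthesis_component_op dot_norm SW_closed bessel_W).
have bQVQ := bounded_operator_comp pKW pKV Q_bounded bQV.
have frame_AV : fusion_frame dot SV AV tv.
  apply: (fusion_frame_right_inverse dot_norm SV_closed bessel_AV
    (bounded_operator_comp pH pKW bTW' bQVQ)) => f Vf /=.
  rewrite TQV; last by apply: (op_dom Q_bounded); exact: (op_dom bTW').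
  by rewrite -/(S f) AS p_id.
have [bQs Q_adj] := adjointP pKW pKV Q_bounded rKW.
rewrite -/Qstar in bQs Q_adj.
have bQWQs := bounded_operator_comp pKV pKW bQs bQW.
have dQs f : dom (Kspace dot W) (Qstar (analysis dot V v f)).
  by apply: (op_dom bQs); exact: (op_dom bTV').
have dual_proj f : synthesis tw (QW (Qstar (analysis dot V v f))) =
    oblique_proj SW (orth dot SV) f.
  apply/esym/(dual_oblique_proj_uniq dot_norm SW_closed H_sum).
    apply: (synthesis_in dot_norm SW_closed bessel_AW).
    exact: (op_dom bQW).
  rewrite TQW// => x Vx; set z := Qstar _.
  (* <x, A* T_W Q* T_V* f> = <T_V Q T_W* A x, f> = <p x, f>, and p x = x. *)
  suff e : dot x (Astar (synthesis w z)) = dot x f.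
    by rewrite dotC linearBr /= e subrr rmorph0.
  have dWx := op_dom bTW' (x := A x) Logic.I.
  transitivity (dot (A x) (synthesis w z)).
    exact/esym/(As_adj x (synthesis w z) Logic.I Logic.I).
  rewrite dotC.
  rewrite (dot_synthesis dot_norm SW_closed bessel_W)//; last exact: dQs.
  rewrite (ipC pKW (dQs f) dWx) conj_scalarK.
  rewrite -Q_adj//; last exact: (op_dom bTV').
  rewrite -(dot_synthesis dot_norm SV_closed bessel_V); last exact: (op_dom Q_bounded).
  by rewrite -/(S (A x)) SA p_id.
have frame_AW : fusion_frame dot SW AstarW tw.
  apply: (fusion_frame_right_inverse dot_norm SW_closed bessel_AW
    (bounded_operator_comp pH pKV bTV' bQWQs)) => f Wf /=.
  rewrite dual_proj; apply: (dual_oblique_proj_uniq dot_norm SW_closed H_sum) => //.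
  by rewrite subrr; exact: orth0.
split.
- split=> //; apply: opnorm_le => // f _ /=.
  rewrite TQV; last by apply: (op_dom Q_bounded); exact: (op_dom bTW').
  by rewrite -/(S f) AS subrr (norm0 pH) mul0r.
- split=> //; apply: opnorm_le => // f _ /=.
  by rewrite dual_proj subrr (norm0 pH) mul0r.
move=> Qi _ _.
have [bQW' QW_adj] := adjointP pKW pKAW bQW rKW.
rewrite -/QWstar in bQW' QW_adj.
have bTAW := (analysisP dot_norm SW_closed bessel_AW).1.
(* The adjoint of T_(A*W) Q_(A* T_W) = A* T_W is T_W* A. *)
have QWs f : QWstar (analysis dot AstarW tw f) = analysis dot W w (A f).
  have dAf := op_dom bTAW (x := f) Logic.I.
  apply: (ip_inj pKW) => [||x dx]; [exact: (op_dom bQW')|exact: (op_dom bTW')|].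
  rewrite -QW_adj// -(dot_synthesis dot_norm SW_closed bessel_AW); last first.
    exact: (op_dom bQW).
  rewrite TQW// -(dot_synthesis dot_norm SW_closed bessel_W)//.
  rewrite dotC [RHS]dotC; congr conj_scalar.
  exact/esym/(As_adj f (synthesis w x) Logic.I Logic.I).
have eps1 : 0 < 1 - eps by rewrite subr_gt0.
split=> //.
- by rewrite divr_ge0// ltW.
- exact: bounded_operator_comp bQW' bQVQ.
apply: opnorm_le => [|f _ /=]; first by rewrite divr_ge0// ltW.
rewrite QWs TQV; last by apply: (op_dom Q_bounded); exact: (op_dom bTW').
rewrite -/(S (A f)) AS pA addrC addKr.
apply: le_trans (D_le _) _; rewrite -mulrA ler_wpM2l//.
rewrite -{2}(AD f); exact: (contraction_norm_le dot_norm eps_lt1 D_le).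
Qed.
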